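(* (i) If $\mathcal{L}$ is a nilpotent finite-dimensional complex Lie algebra, then $r_{P_{\mathfrak{S}^{\max}}}^{\circ}(\mathcal{L})=r_{P_{\mathfrak{J}^{\max}}}^{\circ}(\mathcal{L})=i_{s}(\mathcal{L})$. (ii) If $\mathcal{L}$ is a finite-dimensional complex Lie algebra, then $$i_{s}(\mathcal{N}_{\mathcal{L}})\leq r_{P_{\mathfrak{S}^{\max}}}^{\circ}(\mathcal{L})\leq r_{P_{\mathfrak{J}^{\max}}}^{\circ}(\mathcal{L})=i_{s}(\mathcal{K}_{\mathcal{L}})+1\leq i_{s}(\mathcal{N}_{\mathcal{L}})+1,$$ so that $1\leq r_{P_{\mathfrak{S}^{\max}}}^{\circ}(\mathcal{L})\leq r_{P_{\mathfrak{J}^{\max}}}^{\circ}(\mathcal{L})\leq r_{P_{\mathfrak{S}^{\max}}}^{\circ}(\mathcal{L})+1$.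
   Context: For a finite-dimensional complex Lie algebra $\mathcal{L}$: $P_{\mathfrak{S}^{\max}}(\mathcal{L})$ is the intersection of all maximal proper Lie subalgebras of $\mathcal{L}$ and $P_{\mathfrak{J}^{\max}}(\mathcal{L})$ is the intersection of all maximal proper Lie ideals of $\mathcal{L}$ (an intersection over the empty family being $\mathcal{L}$); both are Lie ideals of $\mathcal{L}$. For $R\in\{P_{\mathfrak{S}^{\max}},P_{\mathfrak{J}^{\max}}\}$ put $R^{0}(\mathcal{L})=\mathcal{L}$, $R^{k+1}(\mathcal{L})=R(R^{k}(\mathcal{L}))$; then $R^{k}(\mathcal{L})=\{0\}$ for large $k$, and $r_{R}^{\circ}(\mathcal{L})$ denotes the smallest $k$ such that $R^{k+1}(\mathcal{L})=R^{k}(\mathcal{L})$, equivalently the smallest $k$ such that $R^{k}(\mathcal{L})=\{0\}$ (the Frattini index for $R=P_{\mathfrak{S}^{\max}}$ and the Jacobson index for $R=P_{\mathfrak{J}^{\max}}$). $\mathrm{rad}(\mathcal{L})$ is the maximal solvable Lie ideal of $\mathcal{L}$, $\mathcal{N}_{\mathcal{L}}$ is the nil-radical (maximal nilpotent Lie ideal) of $\mathcal{L}$, and $\mathcal{K}_{\mathcal{L}}=[\mathcal{L},\mathrm{rad}(\mathcal{L})]$. For a solvable Lie algebra $\mathcal{M}$, with $\mathcal{M}_{[0]}=\mathcal{M}$ and $\mathcal{M}_{[n+1]}=[\mathcal{M}_{[n]},\mathcal{M}_{[n]}]$, the solvability index $i_{s}(\mathcal{M})$ is the least $n$ with $\ma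thcal{M}_{[n]}=\{0\}$.
   Formalization: Part (ii) is stated for nonzero Lie algebras only: for the zero algebra both indices are 0, while the solvability index of [L, rad(L)] plus 1 equals 1, so the printed equality and the bound 1 ≤ r fail. *)

(* Defs.v *)
From HB Require Import structures.
From mathcomp Require Import all_boot all_order all_algebra.
From mathcomp Require Import boolp reals complex.

Set Implicit Arguments.
Unset Strict Implicit.
Unset Printing Implicit Defensive.

Import GRing.Theory.
Local Open Scope ring_scope.

(* Finite dimension is part of vectType. *)
HB.mixin Record isLieAlgebra (K : fieldType) L of Vector K L := {
  lie_bracket : L -> L -> L;
  lie_linearl : forall y : L, linear (lie_bracket^~ y);
  lie_linearr : forall x : L, linear (lie_bracket x);
  lie_alternating : forall x : L, lie_bracket x x = 0;
  lie_jacobi : forall x y z : L,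
    lie_bracket x (lie_bracket y z) + lie_bracket y (lie_bracket z x)
      + lie_bracket z (lie_bracket x y) = 0
}.

#[short(type="lieAlgType")]
HB.structure Definition LieAlgebra (K : fieldType) :=
  {L of isLieAlgebra K L & Vector K L}.

HB.instance Definition _ (K : fieldType) (L : lieAlgType K) (x : L) :=
  GRing.isLinear.Build K L L *:%R (lie_bracket x) (lie_linearr x).

(* Linear span of all the brackets [u, v] with u in U and v in V; bilinearity
   makes the brackets of basis vectors sufficient, see lie_mulP. *)
Definition lie_mul (K : fieldType) (L : lieAlgType K) (U V : {vspace L}) :
  {vspace L} := <<[seq lie_bracket u v | u <- vbasis U, v <- vbasis V]>>%VS.

(* Subalgebras of L, and L itself as {:L}, are handled as subspaces. The notions
   below are relative to such a subspace U, regarded as a Lie algebra on its own: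
   an ideal of U need not be an ideal of L. *)
Definition lie_subalgebra (K : fieldType) (L : lieAlgType K)
  (U A : {vspace L}) : bool := ((A <= U) && (lie_mul A A <= A))%VS.

Definition lie_ideal (K : fieldType) (L : lieAlgType K)
  (U I : {vspace L}) : bool := ((I <= U) && (lie_mul U I <= I))%VS.

Definition maximal_proper (K : fieldType) (V : vectType K)
    (P : pred {vspace V}) (U M : {vspace V}) : Prop :=
  [/\ P M, M != U &
      forall N, P N -> N != U -> (M <= N)%VS -> N = M].

Definition maximal_lie_subalgebra (K : fieldType) (L : lieAlgType K)
  (U : {vspace L}) : {vspace L} -> Prop := maximal_proper (lie_subalgebra U) U.

Definition maximal_lie_ideal (K : fieldType) (L : lieAlgType K)
  (U : {vspace L}) : {vspace L} -> Prop := maximal_proper (lie_ideal U) U.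

Definition lie_derived (K : fieldType) (L : lieAlgType K) (U : {vspace L})
  (n : nat) : {vspace L} := iter n (fun V => lie_mul V V) U.

Definition lie_lower_central (K : fieldType) (L : lieAlgType K)
  (U : {vspace L}) (n : nat) : {vspace L} := iter n (fun V => lie_mul V U) U.

Definition lie_solvable (K : fieldType) (L : lieAlgType K) (U : {vspace L}) :
  Prop := exists n, lie_derived U n == 0%VS.

Definition lie_nilpotent (K : fieldType) (L : lieAlgType K) (U : {vspace L}) :
  Prop := exists n, lie_lower_central U n == 0%VS.

(* The value 0 for a non-solvable U is a placeholder; nilradical_solvable,
   commutator_radical_solvable and nilpotent_solvable below show that it is
   never taken for nilpotent algebras, the nil-radical and [L, rad L]. *)
Definition solvability_index (K : fieldType) (L : lieAlgType K)
  (U : {vspace L}) : nat :=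
  if pselect (lie_solvable U) is left h then ex_minn h else 0%N.

Lemma ex_largest_vspace (K : fieldType) (V : vectType K)
    (P : {vspace V} -> Prop) :
  P 0%VS -> (forall A B, P A -> P B -> P (A + B)%VS) ->
  exists W, P W /\ forall A, P A -> (A <= W)%VS.
Proof.
move=> P0 PD.
pose d n := `[< exists W, P W /\ \dim W = n >].
have exd : exists n, d n by exists (\dim (0%VS : {vspace V})); apply/asboolP; exists 0%VS.
have ubd n : d n -> (n <= \dim {:V})%N.
  by move=> /asboolP[W [_ <-]]; apply/dimvS/subvf.
have [n /asboolP[W [PW dW]] maxn] := ex_maxnP exd ubd.
exists W; split=> // A PA.
have le : (\dim (W + A) <= \dim W)%N.
  by rewrite dW; apply: maxn; apply/asboolP; exists (W + A)%VS; split=> //; apply: PD.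
have /eqP -> : W == (W + A)%VS by rewrite eqEdim addvSl le.
exact: addvSr.
Qed.

Lemma ex_vspace_bigcap (K : fieldType) (V : vectType K) (U : {vspace V})
    (F : {vspace V} -> Prop) :
  exists W : {vspace V},
    forall v, v \in W <-> v \in U /\ forall M, F M -> v \in M.
Proof.
pose P (W : {vspace V}) := (W <= U)%VS /\ forall M, F M -> (W <= M)%VS.
have [||W [[WU WM] maxW]] := @ex_largest_vspace K V P.
- by split=> [|M _]; apply: sub0v.
- move=> A B [AU AM] [BU BM]; split=> [|M FM]; rewrite subv_add.
    by rewrite AU.
  by rewrite AM // BM.
exists W => v; split=> [vW | [vU vM]].
  by split=> [|M /WM/subvP]; [apply: (subvP WU) | apply].
rewrite memvE; apply: maxW; split=> [|M /vM]; by rewrite -memvE.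
Qed.

(* Intersection of U with all the members of F; it is U if F is empty. *)
Definition vspace_bigcap (K : fieldType) (V : vectType K) (U : {vspace V})
  (F : {vspace V} -> Prop) : {vspace V} := sval (cid (ex_vspace_bigcap U F)).

Lemma vspace_bigcapP (K : fieldType) (V : vectType K) (U : {vspace V})
    (F : {vspace V} -> Prop) (v : V) :
  v \in vspace_bigcap U F <-> v \in U /\ forall M, F M -> v \in M.
Proof. exact: (svalP (cid (ex_vspace_bigcap U F))). Qed.

Lemma vspace_bigcapS (K : fieldType) (V : vectType K) (U : {vspace V})
  (F : {vspace V} -> Prop) : (vspace_bigcap U F <= U)%VS.
Proof. by apply/subvP => v /vspace_bigcapP[]. Qed.

Definition frattini_ideal (K : fieldType) (L : lieAlgType K) (U : {vspace L}) :
  {vspace L} := vspace_bigcap U (maximal_lie_subalgebra U).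

Definition jacobson_ideal (K : fieldType) (L : lieAlgType K) (U : {vspace L}) :
  {vspace L} := vspace_bigcap U (maximal_lie_ideal U).

Lemma iter_stationary (K : fieldType) (V : vectType K)
    (R : {vspace V} -> {vspace V}) (U : {vspace V}) :
  (forall W, (R W <= W)%VS) -> exists k, iter k.+1 R U == iter k R U.
Proof.
move=> RS; have [n] := ubnP (\dim U).
elim: n U => // n IHn U ltUn.
have [eqRU | neqRU] := eqVneq (R U) U; first by exists 0%N; rewrite /= eqRU.
have [|k eqk] := IHn (R U); last by exists k.+1; rewrite !(iterSr _ _ U).
rewrite -ltnS; apply: leq_trans ltUn; rewrite !ltnS ltnNge.
by apply: contra neqRU => le; rewrite eqEdim RS.
Qed.

Lemma frattini_stationary (K : fieldType) (L : lieAlgType K) (U : {vspace L}) :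
  exists k, iter k.+1 (@frattini_ideal K L) U == iter k (@frattini_ideal K L) U.
Proof. by apply: iter_stationary => W; apply: vspace_bigcapS. Qed.

Lemma jacobson_stationary (K : fieldType) (L : lieAlgType K) (U : {vspace L}) :
  exists k, iter k.+1 (@jacobson_ideal K L) U == iter k (@jacobson_ideal K L) U.
Proof. by apply: iter_stationary => W; apply: vspace_bigcapS. Qed.

Definition frattini_index (K : fieldType) (L : lieAlgType K) (U : {vspace L}) :
  nat := ex_minn (frattini_stationary U).

Definition jacobson_index (K : fieldType) (L : lieAlgType K) (U : {vspace L}) :
  nat := ex_minn (jacobson_stationary U).

Lemma lie_bracketC (K : fieldType) (L : lieAlgType K) (x y : L) :
  lie_bracket x y = - lie_bracket y x.
Proof.
have D (u v w : L) : lie_bracket (u + v) w = lie_bracket u w + lie_bracket v w.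
  by have := lie_linearl w 1 u v; rewrite !scale1r.
have := lie_alternating (x + y); rewrite D !linearD /= !lie_alternating.
by rewrite add0r addr0 => /eqP; rewrite addr_eq0 => /eqP.
Qed.

Lemma lie_mulP (K : fieldType) (L : lieAlgType K) (U V W : {vspace L}) :
  reflect (forall u v, u \in U -> v \in V -> lie_bracket u v \in W)
          (lie_mul U V <= W)%VS.
Proof.
apply: (iffP idP) => [sub u v uU vV | mem].
  apply: (subvP sub).
  rewrite (coord_vbasis vV) linear_sum; apply: memv_suml => j _ /=.
  rewrite linearZ memvZ //= lie_bracketC memvN.
  rewrite (coord_vbasis uU) linear_sum; apply: memv_suml => i _ /=.
  rewrite linearZ memvZ //= lie_bracketC memvN memv_span //.
  apply/allpairsP; exists ((vbasis U)`_i, (vbasis V)`_j).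
  by split=> //=; apply: mem_nth; rewrite size_tuple.
apply/span_subvP => _ /allpairsP[[u v] [/= uU vV ->]].
by apply: mem; apply: vbasis_mem.
Qed.

Lemma mem_lie_mul (K : fieldType) (L : lieAlgType K) (U V : {vspace L}) u v :
  u \in U -> v \in V -> lie_bracket u v \in lie_mul U V.
Proof. exact: (lie_mulP _ _ _ (subvv _)). Qed.

Lemma lie_mulC (K : fieldType) (L : lieAlgType K) (U V : {vspace L}) :
  lie_mul U V = lie_mul V U.
Proof.
wlog suff sub : U V / (lie_mul U V <= lie_mul V U)%VS.
  by apply/eqP; rewrite eqEsubv !sub.
by apply/lie_mulP => u v uU vV; rewrite lie_bracketC memvN mem_lie_mul.
Qed.

Lemma lie_mulS (K : fieldType) (L : lieAlgType K) (U U' V V' : {vspace L}) :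
  (U <= U')%VS -> (V <= V')%VS -> (lie_mul U V <= lie_mul U' V')%VS.
Proof.
move=> /subvP sU /subvP sV; apply/lie_mulP => u v /sU uU /sV vV.
exact: mem_lie_mul.
Qed.

Lemma lie_mulDr (K : fieldType) (L : lieAlgType K) (U A B : {vspace L}) :
  lie_mul U (A + B) = (lie_mul U A + lie_mul U B)%VS.
Proof.
apply/eqP; rewrite eqEsubv subv_add !lie_mulS ?addvSl ?addvSr // !andbT.
apply/lie_mulP => u _ uU /memv_addP[a aA [b bB ->]].
by rewrite linearD memv_add //; apply: mem_lie_mul.
Qed.

Lemma lie_mul_sumr (K : fieldType) (L : lieAlgType K) (U : {vspace L})
    (n : nat) (F : nat -> {vspace L}) :
  lie_mul U (\sum_(i < n) F i)%VS = (\sum_(i < n) lie_mul U (F i))%VS.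
Proof.
elim: n => [|n IHn]; last by rewrite !big_ord_recr /= lie_mulDr IHn.
rewrite !big_ord0; apply/eqP; rewrite -subv0.
by apply/lie_mulP => u v _; rewrite !memv0 => /eqP->; rewrite linear0.
Qed.

Lemma lie_ideal_fullP (K : fieldType) (L : lieAlgType K) (I : {vspace L}) :
  lie_ideal fullv I = (lie_mul fullv I <= I)%VS.
Proof. by rewrite /lie_ideal subvf. Qed.

Lemma lie_ideal0 (K : fieldType) (L : lieAlgType K) :
  lie_ideal {:L}%VS 0%VS.
Proof.
rewrite lie_ideal_fullP; apply/lie_mulP => u v _; rewrite !memv0 => /eqP->.
by rewrite linear0.
Qed.

Lemma lie_idealD (K : fieldType) (L : lieAlgType K) (I J : {vspace L}) :
  lie_ideal fullv I -> lie_ideal fullv J -> lie_ideal fullv (I + J)%VS.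
Proof. by rewrite !lie_ideal_fullP lie_mulDr => sI sJ; apply: addvS. Qed.

Lemma lie_ideal_mul (K : fieldType) (L : lieAlgType K) (I J : {vspace L}) :
  lie_ideal fullv I -> lie_ideal fullv J -> lie_ideal fullv (lie_mul I J).
Proof.
rewrite !lie_ideal_fullP => /lie_mulP hI /lie_mulP hJ.
apply/lie_mulP => x w _.
suff sub : (lie_mul I J <= linfun (lie_bracket x) @^-1: lie_mul I J)%VS.
  by move=> /(subvP sub); rewrite -memv_preim lfunE.
apply/lie_mulP => u v uI vJ; rewrite -memv_preim lfunE /=.
have /eqP := lie_jacobi x u v; rewrite -addrA addr_eq0 => /eqP->.
rewrite memvN memvD //.
  by apply: mem_lie_mul => //; rewrite lie_bracketC memvN hJ ?memvf.
by rewrite lie_bracketC memvN mem_lie_mul // hI ?memvf.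
Qed.

Lemma lie_derivedS (K : fieldType) (L : lieAlgType K) (U V : {vspace L}) n :
  (U <= V)%VS -> (lie_derived U n <= lie_derived V n)%VS.
Proof. by move=> sUV; elim: n => //= n IHn; apply: lie_mulS. Qed.

Lemma lie_solvableS (K : fieldType) (L : lieAlgType K) (U V : {vspace L}) :
  (U <= V)%VS -> lie_solvable V -> lie_solvable U.
Proof.
move=> sUV [n /eqP Vn0]; exists n.
by rewrite -subv0 -Vn0; apply: lie_derivedS.
Qed.

Lemma lie_solvableD (K : fieldType) (L : lieAlgType K) (I J : {vspace L}) :
  lie_ideal fullv J -> lie_solvable I -> lie_solvable J ->
  lie_solvable (I + J)%VS.
Proof.
rewrite lie_ideal_fullP => hJ [n /eqP In0] [m /eqP Jm0].
have sub k : (lie_derived (I + J)%VS k <= lie_derived I k + J)%VS.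
  elim: k => //= k IHk; apply: subv_trans (lie_mulS IHk IHk) _.
  rewrite lie_mulDr subv_add; apply/andP; split; last first.
    by apply: subv_trans (addvSr _ _); apply: subv_trans hJ; apply/lie_mulS/subvv/subvf.
  rewrite lie_mulC lie_mulDr; apply: addvS => //.
  by apply: subv_trans hJ; apply/lie_mulS/subvv/subvf.
exists (m + n)%N; rewrite /lie_derived iterD -subv0 -Jm0.
by apply: lie_derivedS; have := sub n; rewrite In0 add0v.
Qed.

Lemma nilpotent_solvable (K : fieldType) (L : lieAlgType K) (U : {vspace L}) :
  lie_subalgebra fullv U -> lie_nilpotent U -> lie_solvable U.
Proof.
case/andP=> _ sUU [n /eqP Un0]; exists n; rewrite -subv0 -Un0.
have dU k : (lie_derived U k <= U)%VS.
  by elim: k => //= k IHk; apply: subv_trans (lie_mulS IHk IHk) sUU.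
by elim: n {Un0} => //= n IHn; apply: lie_mulS.
Qed.

Lemma lie_nilpotentD (K : fieldType) (L : lieAlgType K) (I J : {vspace L}) :
  lie_ideal fullv I -> lie_ideal fullv J ->
  lie_nilpotent I -> lie_nilpotent J -> lie_nilpotent (I + J)%VS.
Proof.
move=> hI hJ [n nI] [m nJ].
pose pw (A : {vspace L}) k : {vspace L} := iter k (fun V => lie_mul V A) fullv.
have pwid A k : lie_ideal fullv A -> lie_ideal fullv (pw A k).
  move=> hA; elim: k => [|k IHk]; first by rewrite lie_ideal_fullP subvf.
  exact: lie_ideal_mul.
have pw1 A k : lie_ideal fullv A -> (pw A k.+1 <= lie_lower_central A k)%VS.
  rewrite lie_ideal_fullP => hA; elim: k => //= k IHk.
  exact: lie_mulS.
pose G N := (\sum_(a < N.+1) (pw I a :&: pw J (N - a)%N))%VS.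
have GS N : (lie_mul (G N) (I + J) <= G N.+1)%VS.
  rewrite lie_mulC /G (lie_mul_sumr _ _ (fun a => pw I a :&: pw J (N - a)%N)%VS).
  apply/subv_sumP => a _; rewrite lie_mulC lie_mulDr subv_add.
  have aN : (a <= N)%N by rewrite -ltnS.
  apply/andP; split.
    apply: subv_trans (sumv_sup (lift ord0 a) _ (subvv _)) => //.
    rewrite subv_cap /= /bump /= add1n subSS; apply/andP; split.
      by apply: lie_mulS => //; apply: capvSl.
    have := pwid J (N - a)%N hJ; rewrite lie_ideal_fullP => h.
    apply: subv_trans h; rewrite lie_mulC; apply: lie_mulS; first exact: subvf.
    exact: capvSr.
  apply: subv_trans (sumv_sup (widen_ord (leqnSn _) a) _ (subvv _)) => //.
  rewrite subv_cap /=; apply/andP; split.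
    have := pwid I a hI; rewrite lie_ideal_fullP => h.
    apply: subv_trans h; rewrite lie_mulC; apply: lie_mulS; first exact: subvf.
    exact: capvSl.
  by rewrite subSn //; apply: lie_mulS => //; apply: capvSr.
have lcG N : (lie_lower_central (I + J)%VS N <= G N)%VS.
  elim: N => [|N IHN]; first by rewrite /G big_ord1 /= capvf subvf.
  exact: subv_trans (lie_mulS IHN (subvv _)) (GS N).
have pwS A k j : lie_ideal fullv A -> (k <= j)%N -> (pw A j <= pw A k)%VS.
  move=> hA /subnK <-; elim: (j - k)%N => //= i IHi.
  apply: subv_trans IHi; rewrite lie_mulC.
  have := pwid A (i + k)%N hA; rewrite lie_ideal_fullP => h.
  by apply: subv_trans h; apply/lie_mulS/subvv/subvf.
exists (n.+1 + m.+1)%N; rewrite -subv0; apply: subv_trans (lcG _) _.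
apply/subv_sumP => a _; have [lena | ltan] := leqP n.+1 a.
  apply: subv_trans (capvSl _ _) _; apply: subv_trans (pwS _ _ _ hI lena) _.
  by rewrite -(eqP nI); apply: pw1.
apply: subv_trans (capvSr _ _) _.
apply: subv_trans (pwS _ m.+1 _ hJ _) _; last by rewrite -(eqP nJ); apply: pw1.
have lean : (a <= n.+1)%N by apply: ltnW.
by rewrite leq_subRL ?leq_add2r // (leq_trans lean) // leq_addr.
Qed.

Lemma ex_lie_radical (K : fieldType) (L : lieAlgType K) :
  exists I : {vspace L}, (lie_ideal fullv I /\ lie_solvable I) /\
    forall J, lie_ideal fullv J /\ lie_solvable J -> (J <= I)%VS.
Proof.
apply: (@ex_largest_vspace K L (fun I => lie_ideal fullv I /\ lie_solvable I)).
  by split; [apply: lie_ideal0 | exists 0%N].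
by move=> A B [iA sA] [iB sB]; split; [apply: lie_idealD | apply: lie_solvableD].
Qed.

Lemma ex_lie_nilradical (K : fieldType) (L : lieAlgType K) :
  exists I : {vspace L}, (lie_ideal fullv I /\ lie_nilpotent I) /\
    forall J, lie_ideal fullv J /\ lie_nilpotent J -> (J <= I)%VS.
Proof.
apply: (@ex_largest_vspace K L (fun I => lie_ideal fullv I /\ lie_nilpotent I)).
  by split; [apply: lie_ideal0 | exists 0%N].
by move=> A B [iA sA] [iB sB]; split; [apply: lie_idealD | apply: lie_nilpotentD].
Qed.

Definition lie_radical (K : fieldType) (L : lieAlgType K) : {vspace L} :=
  sval (cid (ex_lie_radical L)).

Definition lie_nilradical (K : fieldType) (L : lieAlgType K) : {vspace L} :=
  sval (cid (ex_lie_nilradical L)).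

Lemma lie_radicalP (K : fieldType) (L : lieAlgType K) :
  (lie_ideal fullv (lie_radical L) /\ lie_solvable (lie_radical L)) /\
  forall J, lie_ideal fullv J /\ lie_solvable J -> (J <= lie_radical L)%VS.
Proof. exact: (svalP (cid (ex_lie_radical L))). Qed.

Lemma lie_nilradicalP (K : fieldType) (L : lieAlgType K) :
  (lie_ideal fullv (lie_nilradical L) /\ lie_nilpotent (lie_nilradical L)) /\
  forall J, lie_ideal fullv J /\ lie_nilpotent J -> (J <= lie_nilradical L)%VS.
Proof. exact: (svalP (cid (ex_lie_nilradical L))). Qed.

Definition commutator_radical (K : fieldType) (L : lieAlgType K) :
  {vspace L} := lie_mul fullv (lie_radical L).

Lemma commutator_radical_solvable (K : fieldType) (L : lieAlgType K) :
  lie_solvable (commutator_radical L).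
Proof.
have [[idR solR] _] := lie_radicalP L.
by apply: lie_solvableS solR; rewrite -lie_ideal_fullP.
Qed.

Lemma nilradical_solvable (K : fieldType) (L : lieAlgType K) :
  lie_solvable (lie_nilradical L).
Proof.
have [[idN nilN] _] := lie_nilradicalP L; apply: nilpotent_solvable => //.
rewrite /lie_subalgebra subvf; move: idN; rewrite lie_ideal_fullP.
by apply: subv_trans; apply/lie_mulS/subvv/subvf.
Qed.

(* Main.v *)
Require Import Defs.
From HB Require Import structures.
From mathcomp Require Import all_boot all_order all_algebra.
From mathcomp Require Import boolp reals complex.

(* Write R = rad L, K = [L, R], F and J for the Frattini and Jacobson operators.
   On a nilpotent algebra F and J both coincide with the derived algebra, so
   everything follows from: K is nilpotent, J(L) = K, and
   [N, N] <= F(L) <= K for the nil-radical N.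

   K is nilpotent because K annihilates every minimal ideal: an ideal A acting
   on it by commuting operators has a common eigenvector, and a commutator
   [x, a] commuting with a has a nontrivial kernel in characteristic 0.

   For F(L), J(L) <= K it suffices to show [L, L] :&: R <= K and F(L/R) = J(L/R)
   = 0. The Killing form of the semisimple algebra L/R is nondegenerate. A linear
   form f vanishing on K satisfies f [x, y] = killing (D x) y for a derivation D
   of L/R; D is inner, so f vanishes on [L, L] :&: R. In L/R every ideal has a
   complementary ideal, so no nonzero ideal lies in all the maximal subalgebras
   or ideals; and F(L/R) is an ideal, as it is stable under exp (ad y) for the
   nilpotent elements ad y, hence under ad y, and these elements generate L/R. *)

Set Implicit Arguments.
Unset Strict Implicit.
Unset Printing Implicit Defensive.

Import Order.TTheory GRing.Theory Num.Theory.
Import VectorInternalTheory.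
Local Open Scope ring_scope.

Local Notation "{[ x , y ]}" := (lie_bracket x y)
  (at level 0, x at level 99, y at level 99, format "{[ x ,  y ]}").

(** Once F(L) and J(L) lie in the nilpotent ideal K, all later iterates are terms of a derived
    series, so either index is one more than the solvability index of the first iterate; the extra 1
    requires L to be nonzero. The chain [N, N] <= F(L) <= K <= N then gives the inequalities. The
    bound by K splits as in the overview because F(L) and J(L) always lie in [L, L] and map into
    F(L/R) and J(L/R). Nondegeneracy of the Killing form is Cartan's criterion: conjugating the
    eigenvalues of [ad x] turns a vanishing trace into a vanishing sum of nonnegative numbers, and
    Engel's theorem finishes. The obstacle is F(L/R), an intersection of subalgebras that is not
    visibly an ideal. Automorphisms permute the maximal subalgebras, so [exp (t ad y)] preserves
    F(L/R) for all t, and [[y, v]] is a coefficient of a polynomial in t with values there. Suitable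
    y are the generalized eigenvectors of any [ad x] for nonzero eigenvalues: they shift eigenvalues
    by a fixed nonzero amount. *)

(** * Subspaces, hyperplanes and maximal members of a family *)

Section Subspaces.
Variables (K : fieldType) (V : vectType K).
Implicit Types (U W : {vspace V}) (P : pred {vspace V}).

(** Comprehension for subspaces: finite dimension gives a largest subspace inside [P], and each
    solution of [P] spans a line inside [P]. Generalized eigenspaces, centralizers and orthogonals
    are obtained this way. *)
Lemma ex_vspace_pred (P : V -> Prop) :
  P 0 -> (forall a u v, P u -> P v -> P (a *: u + v)) ->
  exists W : {vspace V}, forall v, v \in W <-> P v.
Proof.
move=> P0 PD.
pose Q (W : {vspace V}) := forall v, v \in W -> P v.
have [||W [QW maxW]] := @ex_largest_vspace K V Q.
- by move=> v; rewrite memv0 => /eqP->.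
- move=> A B QA QB _ /memv_addP[a /QA Pa [b /QB Pb ->]].
  by rewrite -[a]scale1r; apply: PD.
exists W => v; split=> [/QW //|Pv].
rewrite memvE; apply: maxW => _ /vlineP[a ->].
by rewrite -[a *: v]addr0; apply: PD.
Qed.

(** [H] has largest dimension among the subspaces between [U :&: W] and [U] that avoid [v]: adding a
    vector of [U] outside [H + <[v]>] would still avoid [v]. *)
Lemma ex_hyperplane U W v : v \in U -> v \notin W ->
  exists H : {vspace V},
    [/\ (U :&: W <= H)%VS, (H <= U)%VS, v \notin H & (H + <[v]>)%VS = U].
Proof.
move=> vU vW.
pose Pp H := [&& (U :&: W <= H)%VS, (H <= U)%VS & v \notin H].
pose d n := `[< exists H, Pp H /\ \dim H = n >].
have exd : exists n, d n.
  exists (\dim (U :&: W)); apply/asboolP; exists (U :&: W)%VS; split=> //.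
  by rewrite /Pp subvv capvSl memv_cap (negPf vW) andbF.
have ubd n : d n -> (n <= \dim {:V})%N.
  by move=> /asboolP[H [_ <-]]; apply/dimvS/subvf.
have [n /asboolP[H [/and3P[UWH HU vH] dH]] maxn] := ex_maxnP exd ubd.
exists H; split=> //; apply/eqP; rewrite eqEsubv subv_add HU -memvE vU /=.
apply/subvP => u uU; apply/negPn/negP => uHv.
have : (\dim (H + <[u]>) <= \dim H)%N.
  rewrite dH; apply: maxn; apply/asboolP; exists (H + <[u]>)%VS; split=> //.
  rewrite /Pp (subv_trans UWH (addvSl _ _)) subv_add HU -memvE uU /=.
  apply/negP => /memv_addP[h hH [_ /vlineP[a ->] def_v]].
  have [a0|a0] := eqVneq a 0; first by rewrite def_v a0 scale0r addr0 hH in vH.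
  case/negP: uHv; rewrite -[u](scalerK a0) memvZ //.
  have -> : a *: u = - h + v by rewrite def_v addKr.
  by rewrite memv_add ?memvN ?memv_line.
move=> le; have /eqP eqH : H == (H + <[u]>)%VS by rewrite eqEdim addvSl.
case/negP: uHv; apply: (subvP (addvSl _ _)); rewrite eqH.
by rewrite (subvP (addvSr _ _)) // memv_line.
Qed.

Lemma ex_maximal_proper P U W : (forall N, P N -> N <= U)%VS ->
  P W -> W != U -> exists M, maximal_proper P U M /\ (W <= M)%VS.
Proof.
move=> PU PW WU.
pose d n := `[< exists H, [/\ P H, H != U, (W <= H)%VS & \dim H = n] >].
have exd : exists n, d n by exists (\dim W); apply/asboolP; exists W.
have ubd n : d n -> (n <= \dim {:V})%N.
  by move=> /asboolP[H [_ _ _ <-]]; apply/dimvS/subvf.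
have [n /asboolP[H [PH HU WH dH]] maxn] := ex_maxnP exd ubd.
exists H; split=> //; split=> // N PN NU HN; apply/esym/eqP.
rewrite eqEdim HN dH; apply: maxn; apply/asboolP; exists N; split=> //.
exact: subv_trans HN.
Qed.

Lemma hyperplane_maximal P U H v :
    (forall N, P N -> N <= U)%VS -> P H -> v \notin H -> (H + <[v]>)%VS = U ->
  maximal_proper P U H.
Proof.
move=> PU PH vH defU; split=> //.
  by apply: contraNneq vH => ->; rewrite -defU (subvP (addvSr _ _)) ?memv_line.
move=> N PN NU HN; apply/eqP; rewrite eqEsubv HN andbT; apply/subvP => n nN.
have : n \in U by apply: subvP nN; apply: PU.
rewrite -defU => /memv_addP[h hH [_ /vlineP[a ->] def_n]].
have [a0|a0] := eqVneq a 0; first by rewrite def_n a0 scale0r addr0.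
case/negP: NU; rewrite eqEsubv PU // -defU subv_add HN -memvE /=.
rewrite -[v](scalerK a0) memvZ // (_ : a *: v = - h + n).
  by rewrite memvD ?memvN // (subvP HN).
by rewrite def_n addKr.
Qed.

End Subspaces.

(** * Frattini and Jacobson ideals of nilpotent algebras *)

Section Brackets.
Variables (K : fieldType) (L : lieAlgType K).
Implicit Types (x y z : L) (U V W A B I J M P : {vspace L}).

Lemma brDl x y z : {[x + y, z]} = {[x, z]} + {[y, z]}.
Proof. by have := lie_linearl z 1 x y; rewrite !scale1r. Qed.

Lemma brDr x y z : {[x, y + z]} = {[x, y]} + {[x, z]}.
Proof. exact: raddfD. Qed.

Lemma brZr a x y : {[x, a *: y]} = a *: {[x, y]}.
Proof. exact: linearZ. Qed.

Lemma brZl a x y : {[a *: x, y]} = a *: {[x, y]}.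
Proof. by rewrite lie_bracketC brZr -scalerN -lie_bracketC. Qed.

Lemma br0r x : {[x, 0]} = 0. Proof. exact: raddf0. Qed.

Lemma br0l x : {[0, x]} = 0. Proof. by rewrite lie_bracketC br0r oppr0. Qed.

Lemma brNr x y : {[x, - y]} = - {[x, y]}. Proof. exact: raddfN. Qed.

Lemma brNl x y : {[- x, y]} = - {[x, y]}.
Proof. by rewrite lie_bracketC brNr -lie_bracketC. Qed.

Lemma brBr x y z : {[x, y - z]} = {[x, y]} - {[x, z]}.
Proof. exact: raddfB. Qed.

Lemma brBl x y z : {[x - y, z]} = {[x, z]} - {[y, z]}.
Proof. by rewrite brDl brNl. Qed.

Lemma br_jacobi x y z : {[x, {[y, z]}]} = {[{[x, y]}, z]} + {[y, {[x, z]}]}.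
Proof.
have /eqP := lie_jacobi x y z; rewrite -addrA addr_eq0 => /eqP ->.
rewrite opprD addrC; congr (_ + _); first by rewrite -lie_bracketC.
by rewrite -brNr -lie_bracketC.
Qed.

Lemma lie_mulDl U V W : lie_mul (U + V) W = (lie_mul U W + lie_mul V W)%VS.
Proof. by rewrite ![lie_mul _ W]lie_mulC lie_mulDr. Qed.

Lemma lie_idealP U I :
  reflect ((I <= U)%VS /\ forall u v, u \in U -> v \in I -> {[u, v]} \in I)
          (lie_ideal U I).
Proof. by apply: (iffP andP) => -[IU /lie_mulP]. Qed.

Lemma lie_subalgebraP U A :
  reflect ((A <= U)%VS /\ forall u v, u \in A -> v \in A -> {[u, v]} \in A)
          (lie_subalgebra U A).
Proof. by apply: (iffP andP) => -[AU /lie_mulP]. Qed.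

Lemma ideal_subalgebra U I : lie_ideal U I -> lie_subalgebra U I.
Proof.
move=> /lie_idealP[IU hI]; apply/lie_subalgebraP; split=> // u v uI vI.
by apply: hI => //; apply: subvP uI.
Qed.

Lemma ideal_brl I x y : lie_ideal fullv I -> x \in I -> {[x, y]} \in I.
Proof.
by move=> /lie_idealP[_ hI] xI; rewrite lie_bracketC memvN hI ?memvf.
Qed.

Lemma ideal_brr I x y : lie_ideal fullv I -> y \in I -> {[x, y]} \in I.
Proof. by move=> /lie_idealP[_ hI] xI; rewrite hI ?memvf. Qed.

Lemma lie_idealf : lie_ideal {:L}%VS {:L}%VS.
Proof. by rewrite lie_ideal_fullP subvf. Qed.

Lemma lie_derived_ideal I n : lie_ideal fullv I -> lie_ideal fullv (lie_derived I n).
Proof. by move=> hI; elim: n => //= n IHn; apply: lie_ideal_mul. Qed.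

Lemma lie_derivedD U m n :
  lie_derived U (m + n) = lie_derived (lie_derived U n) m.
Proof. exact: iterD. Qed.

Lemma lie_derived1 U n : lie_derived (lie_mul U U) n = lie_derived U n.+1.
Proof. by rewrite -addn1 lie_derivedD. Qed.

Lemma lie_mulv0 U : lie_mul U 0 = 0%VS.
Proof.
apply/eqP; rewrite -subv0; apply/lie_mulP => u v _; rewrite !memv0 => /eqP->.
by rewrite br0r.
Qed.

Lemma lie_derived0 n : lie_derived (0%VS : {vspace L}) n = 0%VS.
Proof. by elim: n => //= n ->; apply: lie_mulv0. Qed.

Lemma lie_lower_centralS U V n :
  (U <= V)%VS -> (lie_lower_central U n <= lie_lower_central V n)%VS.
Proof. by move=> sUV; elim: n => //= n IHn; apply: lie_mulS. Qed.

Lemma lie_nilpotentS U V : (U <= V)%VS -> lie_nilpotent V -> lie_nilpotent U.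
Proof.
move=> sUV [n /eqP Vn0]; exists n.
by rewrite -subv0 -Vn0; apply: lie_lower_centralS.
Qed.

Lemma subalgebra_mul U : lie_subalgebra fullv U -> (lie_mul U U <= U)%VS.
Proof. by case/andP. Qed.

(** Generators modulo [[P, P]] generate a nilpotent [P]: inserting [P <= M + P_k] into both factors
    of [[P, P]] gives [P <= M + P_(k+1)], with [P_k] the lower central series. *)
Lemma nilpotent_generate P M : (lie_mul P P <= P)%VS -> lie_nilpotent P ->
  (M <= P)%VS -> (lie_mul M M <= M)%VS -> (P <= M + lie_mul P P)%VS -> (P <= M)%VS.
Proof.
move=> PP [n /eqP Pn0] MP MM gen.
suff sub : forall k, (P <= M + lie_lower_central P k)%VS.
  by have := sub n; rewrite Pn0 addv0.
have lcP k : (lie_lower_central P k <= P)%VS.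
  by elim: k => //= k IHk; apply: subv_trans PP; apply: lie_mulS.
elim=> [|k IHk]; first by rewrite /= addvSr.
apply: subv_trans gen _; rewrite subv_add addvSl /=.
apply: subv_trans (lie_mulS IHk IHk) _.
rewrite lie_mulDr !lie_mulDl !subv_add (subv_trans MM (addvSl _ _)) /=.
have mulP A B : (A <= lie_lower_central P k)%VS -> (B <= P)%VS ->
    (lie_mul A B <= M + lie_mul (lie_lower_central P k) P)%VS.
  by move=> sA sB; apply: subv_trans (addvSr _ _); apply: lie_mulS.
by rewrite mulP // [lie_mul M _]lie_mulC !mulP.
Qed.

Lemma frattini_max P M : maximal_lie_subalgebra P M -> (frattini_ideal P <= M)%VS.
Proof. by move=> maxM; apply/subvP => v /vspace_bigcapP[_]; apply. Qed.

Lemma jacobson_max P M : maximal_lie_ideal P M -> (jacobson_ideal P <= M)%VS.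
Proof. by move=> maxM; apply/subvP => v /vspace_bigcapP[_]; apply. Qed.

Lemma hyperplane_ideal P H : (lie_mul P P <= H)%VS -> (H <= P)%VS -> lie_ideal P H.
Proof.
by move=> sPH sHP; rewrite /lie_ideal sHP (subv_trans _ sPH) // lie_mulS.
Qed.

(** A vector outside [[P, P]] is avoided by a hyperplane containing [[P, P]]; such a hyperplane is
    an ideal, hence a maximal subalgebra. *)
Lemma frattini_sub_derived P :
  (lie_mul P P <= P)%VS -> (frattini_ideal P <= lie_mul P P)%VS.
Proof.
move=> PP; apply/subvP => v vF; apply/negPn/negP => vPP.
have vP : v \in P by apply: subvP vF; apply: vspace_bigcapS.
have [H [PPH HP vH defP]] := ex_hyperplane vP vPP.
apply: (negP vH); apply: subvP vF; apply: frattini_max.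
apply: hyperplane_maximal vH defP => [N /andP[]//|].
apply: ideal_subalgebra; apply: hyperplane_ideal HP.
by rewrite (capv_idPr PP) in PPH.
Qed.

Lemma jacobson_sub_derived P :
  (lie_mul P P <= P)%VS -> (jacobson_ideal P <= lie_mul P P)%VS.
Proof.
move=> PP; apply/subvP => v vF; apply/negPn/negP => vPP.
have vP : v \in P by apply: subvP vF; apply: vspace_bigcapS.
have [H [PPH HP vH defP]] := ex_hyperplane vP vPP.
apply: (negP vH); apply: subvP vF; apply: jacobson_max.
apply: hyperplane_maximal vH defP => [N /andP[]//|].
by apply: hyperplane_ideal HP; rewrite (capv_idPr PP) in PPH.
Qed.

(** A maximal subalgebra not containing [[P, P]] would span [P] together with it, and so be [P] by
    [nilpotent_generate]. *)
Lemma derived_sub_frattini P : (lie_mul P P <= P)%VS -> lie_nilpotent P ->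
  (lie_mul P P <= frattini_ideal P)%VS.
Proof.
move=> PP nilP; apply/subvP => v vPP; apply/vspace_bigcapP; split.
  exact: subvP vPP.
move=> M [/andP[MP MM] MneP maxM].
have subM : lie_subalgebra P (M + lie_mul P P)%VS.
  rewrite /lie_subalgebra subv_add MP PP /= lie_mulDr !lie_mulDl !subv_add.
  rewrite (subv_trans MM (addvSl _ _)) /=.
  by rewrite !(subv_trans _ (addvSr M (lie_mul P P))) // lie_mulS.
have [eqP|neP] := eqVneq (M + lie_mul P P)%VS P.
  case/negP: MneP; rewrite eqEsubv MP.
  by apply: nilpotent_generate => //; rewrite eqP.
by rewrite -(maxM _ subM neP (addvSl _ _)) (subvP (addvSr _ _)).
Qed.

Lemma derived_sub_jacobson P : (lie_mul P P <= P)%VS -> lie_nilpotent P ->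
  (lie_mul P P <= jacobson_ideal P)%VS.
Proof.
move=> PP nilP; apply/subvP => v vPP; apply/vspace_bigcapP; split.
  exact: subvP vPP.
move=> M [/andP[MP PM] MneP maxM].
have MM : (lie_mul M M <= M)%VS by apply: subv_trans PM; apply: lie_mulS.
have idM : lie_ideal P (M + lie_mul P P)%VS.
  rewrite /lie_ideal subv_add MP PP /= lie_mulDr subv_add.
  rewrite (subv_trans PM (addvSl _ _)) /=.
  by rewrite (subv_trans _ (addvSr M (lie_mul P P))) // lie_mulS.
have [eqP|neP] := eqVneq (M + lie_mul P P)%VS P.
  case/negP: MneP; rewrite eqEsubv MP.
  by apply: nilpotent_generate => //; rewrite eqP.
by rewrite -(maxM _ idM neP (addvSl _ _)) (subvP (addvSr _ _)).
Qed.

Lemma frattini_nilpotent P : (lie_mul P P <= P)%VS -> lie_nilpotent P ->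
  frattini_ideal P = lie_mul P P.
Proof.
by move=> PP nP; apply/eqP; rewrite eqEsubv frattini_sub_derived ?derived_sub_frattini.
Qed.

Lemma jacobson_nilpotent P : (lie_mul P P <= P)%VS -> lie_nilpotent P ->
  jacobson_ideal P = lie_mul P P.
Proof.
by move=> PP nP; apply/eqP; rewrite eqEsubv jacobson_sub_derived ?derived_sub_jacobson.
Qed.

Lemma lie_derived_sub P n : (lie_mul P P <= P)%VS -> (lie_derived P n <= P)%VS.
Proof.
by move=> PP; elim: n => //= n IHn; apply: subv_trans PP; apply: lie_mulS.
Qed.

Lemma lie_derived_mul_sub P n : (lie_mul P P <= P)%VS ->
  (lie_mul (lie_derived P n) (lie_derived P n) <= lie_derived P n)%VS.
Proof. by move=> PP; elim: n => //= n IHn; apply: lie_mulS. Qed.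

Lemma iter_frattini_nilpotent P k : (lie_mul P P <= P)%VS -> lie_nilpotent P ->
  iter k (@frattini_ideal K L) P = lie_derived P k.
Proof.
move=> PP nP; elim: k => //= k ->; apply: frattini_nilpotent.
  exact: lie_derived_mul_sub.
by apply: lie_nilpotentS nP; apply: lie_derived_sub.
Qed.

Lemma iter_jacobson_nilpotent P k : (lie_mul P P <= P)%VS -> lie_nilpotent P ->
  iter k (@jacobson_ideal K L) P = lie_derived P k.
Proof.
move=> PP nP; elim: k => //= k ->; apply: jacobson_nilpotent.
  exact: lie_derived_mul_sub.
by apply: lie_nilpotentS nP; apply: lie_derived_sub.
Qed.

(** Links the two kinds of index: the Frattini and Jacobson indices count up to the first
    repetition, the solvability index up to 0, and a derived series that reaches 0 cannot become
    constant earlier. *)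
Lemma lie_derived_stationary P n : lie_solvable P ->
  (lie_derived P n.+1 == lie_derived P n) = (lie_derived P n == 0%VS).
Proof.
move=> [m /eqP Pm0]; apply/eqP/eqP => [st|P0]; last by rewrite /= P0 lie_mulv0.
have all k : lie_derived P (k + n) = lie_derived P n.
  by elim: k => // k IHk; rewrite addSn /= IHk.
by rewrite -(all m) addnC lie_derivedD Pm0 lie_derived0.
Qed.

Lemma solvability_indexP P n : lie_solvable P ->
  lie_derived P n == 0%VS -> (forall m, lie_derived P m == 0%VS -> n <= m)%N ->
  solvability_index P = n.
Proof.
move=> sP Pn0 minn; rewrite /solvability_index.
case: pselect => // h; case: ex_minnP => m Pm0 minm.
by apply/eqP; rewrite eqn_leq minm // minn.
Qed.

Lemma solvability_index_spec P : lie_solvable P ->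
  lie_derived P (solvability_index P) == 0%VS /\
  forall m, lie_derived P m == 0%VS -> (solvability_index P <= m)%N.
Proof.
move=> sP; rewrite /solvability_index; case: pselect => // h.
by case: ex_minnP.
Qed.

Lemma solvability_indexS P P' : lie_solvable P' -> (P <= P')%VS ->
  (solvability_index P <= solvability_index P')%N.
Proof.
move=> sP' PP'; have [_ minP] := solvability_index_spec (lie_solvableS PP' sP').
have [/eqP P'0 _] := solvability_index_spec sP'.
by apply: minP; rewrite -subv0 -P'0; apply: lie_derivedS.
Qed.

Lemma solvability_index_mul P : lie_solvable P ->
  (solvability_index P <= solvability_index (lie_mul P P) + 1)%N.
Proof.
move=> sP; have [_ minP] := solvability_index_spec sP.
have sPP : lie_solvable (lie_mul P P).
  by case: sP => m /eqP Pm0; exists m; rewrite lie_derived1 /= Pm0 lie_mulv0.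
have [PP0 _] := solvability_index_spec sPP.
by apply: minP; rewrite addn1 -lie_derived1.
Qed.

(* R stands for the Frattini or the Jacobson operator; only its first value
   may fail to be the derived algebra. *)
Lemma stationary_index (R : {vspace L} -> {vspace L}) U
    (ex : exists k, iter k.+1 R U == iter k R U) :
    R U != U -> lie_solvable (R U) ->
    (forall k, iter k R (R U) = lie_derived (R U) k) ->
  ex_minn ex = (solvability_index (R U) + 1)%N.
Proof.
move=> RU sRU defR; have [S0 minS] := solvability_index_spec sRU.
(* Iterate [k.+1] from [U] is iterate [k] from [R U]; this shift is the [+ 1] of the conclusion, and
   [RU] excludes the value 0 below. *)
have st k : (iter k.+2 R U == iter k.+1 R U) = (lie_derived (R U) k == 0%VS).
  by rewrite !iterSr -iterSr !defR lie_derived_stationary.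
case: ex_minnP => -[|k]; first by rewrite /= (negPf RU).
rewrite st => Pk0 mink; apply/eqP.
by rewrite eqn_leq addn1 mink ?st // ltnS minS.
Qed.

Lemma nilpotent_indexes : lie_nilpotent {:L}%VS ->
  frattini_index {:L}%VS = solvability_index {:L}%VS /\
  jacobson_index {:L}%VS = solvability_index {:L}%VS.
Proof.
move=> nL; have LL : (lie_mul {:L} {:L} <= {:L})%VS by apply: subvf.
have sL : lie_solvable {:L}%VS.
  by apply: nilpotent_solvable => //; rewrite /lie_subalgebra subvf.
split; apply/esym/solvability_indexP => //; rewrite /frattini_index /jacobson_index.
- by case: ex_minnP => n; rewrite !iter_frattini_nilpotent // lie_derived_stationary.
- case: ex_minnP => n _ minn m m0; apply: minn.
  by rewrite !iter_frattini_nilpotent // lie_derived_stationary.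
- by case: ex_minnP => n; rewrite !iter_jacobson_nilpotent // lie_derived_stationary.
- case: ex_minnP => n _ minn m m0; apply: minn.
  by rewrite !iter_jacobson_nilpotent // lie_derived_stationary.
Qed.

End Brackets.

(** * Quotient Lie algebras *)

Section Quotient.
Variables (K : fieldType) (L : lieAlgType K) (I : {vspace L}).
Hypothesis idI : lie_ideal fullv I.

(* The quotient by I is carried by the complement of I. *)
Definition lie_quo of lie_ideal fullv I := subvs_of (I^C)%VS.
Local Notation Q := (lie_quo idI).
HB.instance Definition _ := Vector.on Q.

Definition quo_proj (v : L) : Q := vsproj (I^C)%VS (v - projv I v).
Definition quo_lift (q : Q) : L := vsval q.

Lemma quo_projE v : quo_lift (quo_proj v) = v - projv I v.
Proof. by rewrite /quo_lift /quo_proj vsprojK // memv_projC. Qed.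

Lemma quo_proj_linear : linear quo_proj.
Proof.
move=> a u v; rewrite /quo_proj -linearP /=; congr (vsproj _ _).
by rewrite linearD linearZ /= opprD addrACA -scalerBr.
Qed.

HB.instance Definition _ :=
  GRing.isLinear.Build K L Q *:%R quo_proj quo_proj_linear.

Lemma quo_lift_linear : linear quo_lift.
Proof. by move=> a u v; rewrite /quo_lift linearP. Qed.

HB.instance Definition _ :=
  GRing.isLinear.Build K Q L *:%R quo_lift quo_lift_linear.

Lemma quo_liftK : cancel quo_lift quo_proj.
Proof.
move=> q; have : quo_lift q \in (I^C)%VS by apply: subvsP.
rewrite -lker_proj memv_ker /quo_proj => /eqP->.
by rewrite subr0 /quo_lift vsvalK.
Qed.

Lemma quo_proj_eq0 v : (quo_proj v == 0) = (v \in I).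
Proof.
apply/eqP/idP => [v0|vI].
  have := quo_projE v; rewrite v0 linear0 => /esym/eqP.
  by rewrite subr_eq0 => /eqP->; apply: memv_proj.
by rewrite /quo_proj projv_id // subrr linear0.
Qed.

Definition quo_bracket (x y : Q) : Q := quo_proj {[quo_lift x, quo_lift y]}.

Lemma quo_proj_bracket x y :
  quo_bracket (quo_proj x) (quo_proj y) = quo_proj {[x, y]}.
Proof.
apply/eqP; rewrite -subr_eq0 -linearB /= quo_proj_eq0 !quo_projE.
rewrite brBl brBr addrAC [X in X - _]addrAC subrr sub0r.
rewrite -opprD memvN memvD //; last exact/ideal_brl/memv_proj.
exact/ideal_brr/memv_proj.
Qed.

Fact quo_linearl y : linear (quo_bracket^~ y).
Proof. by move=> a u v; rewrite /quo_bracket linearP brDl brZl linearP. Qed.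

Fact quo_linearr x : linear (quo_bracket x).
Proof. by move=> a u v; rewrite /quo_bracket !linearP. Qed.

Fact quo_alternating x : quo_bracket x x = 0.
Proof. by rewrite /quo_bracket lie_alternating linear0. Qed.

Fact quo_jacobi x y z : quo_bracket x (quo_bracket y z)
  + quo_bracket y (quo_bracket z x) + quo_bracket z (quo_bracket x y) = 0.
Proof.
rewrite -[x]quo_liftK -[y]quo_liftK -[z]quo_liftK !quo_proj_bracket.
by rewrite -!linearD /= lie_jacobi linear0.
Qed.

HB.instance Definition _ := isLieAlgebra.Build K Q
  quo_linearl quo_linearr quo_alternating quo_jacobi.

End Quotient.

(** Later proofs see the quotient only through the projection [p] and a section [s], which is linear
    but in general no morphism of Lie algebras. *)
Lemma ex_lie_quotient (K : fieldType) (L : lieAlgType K) (I : {vspace L}) :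
  lie_ideal fullv I -> exists (Q : lieAlgType K) (p : 'Hom(L, Q)) (s : 'Hom(Q, L)),
    [/\ forall x y, p {[x, y]} = {[p x, p y]}, cancel s p &
        forall v, (p v == 0) = (v \in I)].
Proof.
move=> idI.
exists (lie_quo idI), (linfun (quo_proj idI)), (linfun (@quo_lift _ _ _ idI)).
split=> [x y|q|v]; rewrite !lfunE /= ?quo_proj_eq0 //.
  exact/esym/quo_proj_bracket.
exact: quo_liftK.
Qed.

(** * Images and preimages under surjective morphisms *)

Section Surjection.
Variables (K : fieldType) (L Q : lieAlgType K) (p : 'Hom(L, Q)) (s : 'Hom(Q, L)).
Hypotheses (pbr : forall x y, p {[x, y]} = {[p x, p y]}) (sK : cancel s p).
Implicit Types (A B I : {vspace L}) (M : {vspace Q}).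

Lemma img_lie_mul A B : (p @: lie_mul A B)%VS = lie_mul (p @: A) (p @: B).
Proof.
apply/eqP; rewrite eqEsubv; apply/andP; split; last first.
  apply/lie_mulP => _ _ /memv_imgP[a aA ->] /memv_imgP[b bB ->].
  by rewrite -pbr memv_img ?mem_lie_mul.
suff sub : (lie_mul A B <= p @^-1: lie_mul (p @: A) (p @: B))%VS.
  by apply/subvP => _ /memv_imgP[v /(subvP sub) vAB ->]; rewrite -memv_preim in vAB.
by apply/lie_mulP => a b aA bB; rewrite -memv_preim pbr mem_lie_mul ?memv_img.
Qed.

Lemma img_full : (p @: fullv)%VS = fullv.
Proof.
apply/eqP; rewrite eqEsubv subvf /=; apply/subvP => q _.
by rewrite -[q]sK memv_img ?memvf.
Qed.

Lemma img_ideal A : lie_ideal fullv A -> lie_ideal fullv (p @: A).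
Proof. by rewrite !lie_ideal_fullP -img_full -img_lie_mul => /limgS. Qed.

Lemma img_lie_derived A n : (p @: lie_derived A n)%VS = lie_derived (p @: A) n.
Proof. by elim: n => //= n <-; rewrite img_lie_mul. Qed.

Lemma img_lie_solvable A : lie_solvable A -> lie_solvable (p @: A).
Proof. by move=> [n /eqP An]; exists n; rewrite -img_lie_derived An limg0. Qed.

Lemma preim_ideal M : lie_ideal fullv M -> lie_ideal fullv (p @^-1: M).
Proof.
move=> hM; apply/lie_idealP; split=> [|x y _]; first exact: subvf.
by rewrite -!memv_preim pbr; apply: ideal_brr.
Qed.

Lemma preim_subalgebra M : lie_subalgebra fullv M -> lie_subalgebra fullv (p @^-1: M).
Proof.
move=> /lie_subalgebraP[_ hM]; apply/lie_subalgebraP; split=> [|x y].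
  exact: subvf.
by rewrite -!memv_preim pbr; apply: hM.
Qed.

Lemma img_preim M : (p @: (p @^-1: M))%VS = M.
Proof.
by apply: lpreimK; apply/subvP => q _; rewrite img_full memvf.
Qed.

Lemma preim_img A : (lker p <= A)%VS -> (p @^-1: (p @: A))%VS = A.
Proof.
move=> kA; apply/eqP; rewrite eqEsubv; apply/andP; split; apply/subvP => v.
  rewrite -memv_preim => /memv_imgP[a aA pv].
  by rewrite -(subrK a v) memvD // (subvP kA) // memv_ker linearB /= pv subrr.
by move=> vA; rewrite -memv_preim memv_img.
Qed.

Lemma img_subalgebra A : lie_subalgebra fullv A -> lie_subalgebra fullv (p @: A).
Proof. by rewrite /lie_subalgebra !subvf /= -img_lie_mul => /limgS. Qed.

(** [P] and [P'] are both the subalgebras or both the ideals. A subspace above [p @^-1: M] contains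
    the kernel, so it is recovered from its image. *)
Lemma preim_maximal (P : pred {vspace L}) (P' : pred {vspace Q}) M :
    (forall N, P N -> P' (p @: N)%VS) -> (forall N, P' N -> P (p @^-1: N)%VS) ->
  maximal_proper P' fullv M -> maximal_proper P fullv (p @^-1: M).
Proof.
move=> PP' P'P [PM Mf maxM]; split; first exact: P'P.
  by apply: contraNneq Mf => Mf; rewrite -(img_preim M) Mf img_full.
move=> N PN Nf MN.
have kN : (lker p <= N)%VS.
  apply: subv_trans MN; apply/subvP => v.
  by rewrite memv_ker -memv_preim => /eqP->; rewrite mem0v.
rewrite -(maxM (p @: N)%VS) ?preim_img //.
- exact: PP'.
- apply: contraNneq Nf => Nf; rewrite -(preim_img kN) Nf eqEsubv subvf /=.
  by apply/subvP => v _; rewrite -memv_preim memvf.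
- by rewrite -(img_preim M) limgS.
Qed.

Lemma img_frattini v : v \in frattini_ideal {:L}%VS -> p v \in frattini_ideal {:Q}%VS.
Proof.
move=> /vspace_bigcapP[_ hv]; apply/vspace_bigcapP; split=> [|M maxM].
  exact: memvf.
rewrite memv_preim; apply: hv; apply: preim_maximal maxM => N.
  exact: img_subalgebra.
exact: preim_subalgebra.
Qed.

Lemma img_jacobson v : v \in jacobson_ideal {:L}%VS -> p v \in jacobson_ideal {:Q}%VS.
Proof.
move=> /vspace_bigcapP[_ hv]; apply/vspace_bigcapP; split=> [|M maxM].
  exact: memvf.
rewrite memv_preim; apply: hv; apply: preim_maximal maxM => N.
  exact: img_ideal.
exact: preim_ideal.
Qed.

End Surjection.

(** * Linear operators: spectrum, iterates and trace *)

(** [s] lists the roots of the characteristic polynomial with multiplicity. The last clause is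
    Cayley-Hamilton with the linear factors applied one at a time, which suits induction on [s]. *)
Lemma mx_split (K : closedFieldType) (n : nat) (A : 'M[K]_n) : exists s : seq K,
  [/\ \tr A = \sum_(r <- s) r, forall a, (a \in s) = eigenvalue A a &
      forall v : 'rV_n, foldl (fun u r => u *m (A - r%:M)) v s = 0].
Proof.
have [s /esym] := closed_field_poly_normal (char_poly A).
rewrite (monicP (char_poly_monic A)) scale1r => defA.
have size_s : size s = n.
  by apply: succn_inj; rewrite -(size_char_poly A) -defA size_prod_XsubC.
exists s; split.
- case: n => [|n] in A defA size_s *.
    by rewrite (size0nil size_s) big_nil /mxtrace big_ord0.
  apply: oppr_inj; rewrite -char_poly_trace // -defA -size_s.
  by rewrite coefPn_prod_XsubC // size_s.
- by move=> a; rewrite eigenvalue_root_char -defA root_prod_XsubC.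
case: n => [|n] in A defA size_s * => v.
  by rewrite (size0nil size_s) /=; apply/rowP => -[].
suff -> (t : seq K) : foldl (fun u r => u *m (A - r%:M)) v t
    = v *m horner_mx A (\prod_(r <- t) ('X - r%:P)).
  by rewrite defA Cayley_Hamilton mulmx0.
elim: t v => [|r t IHt] v; first by rewrite big_nil rmorph1 mulmx1.
by rewrite big_cons rmorphM rmorphB /= horner_mx_X horner_mx_C mulmxA -IHt.
Qed.

Lemma lfunB (K : fieldType) (V W : vectType K) (f : 'Hom(V, W)) u v :
  f (u - v) = f u - f v.
Proof. exact: raddfB. Qed.

Lemma lfun_linear (K : fieldType) (V W : vectType K) (f : 'Hom(V, W)) a u v :
  f (a *: u + v) = a *: f u + f v.
Proof. exact: linearP. Qed.

Lemma lfunZ (K : fieldType) (V W : vectType K) (f : 'Hom(V, W)) a v :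
  f (a *: v) = a *: f v.
Proof. exact: linearZ. Qed.

Section LinearOperators.
Variables (K : fieldType) (V : vectType K).
Implicit Types (f g : 'End(V)) (U W : {vspace V}).

Lemma iter_linear f n : linear (iter n f).
Proof. by elim: n => [|n IHn] a u v //; rewrite !iterS IHn linearP. Qed.

Lemma iter_lfun0 f n : iter n f 0 = 0.
Proof. by elim: n => //= n ->; rewrite linear0. Qed.

Lemma iter_lfunD f n u v : iter n f (u + v) = iter n f u + iter n f v.
Proof. by have := iter_linear f n 1 u v; rewrite !scale1r. Qed.

Lemma iter_lfunZ f n a v : iter n f (a *: v) = a *: iter n f v.
Proof. by have := iter_linear f n a v 0; rewrite iter_lfun0 !addr0. Qed.

Lemma iter_lfunB f n u v : iter n f (u - v) = iter n f u - iter n f v.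
Proof. by rewrite -scaleN1r iter_lfunD iter_lfunZ scaleN1r. Qed.

Lemma iter_lfun_stable f U n v :
  (forall u, u \in U -> f u \in U) -> v \in U -> iter n f v \in U.
Proof. by move=> fU vU; elim: n => //= n; apply: fU. Qed.

Lemma iter_lfun_kill f m n v : (m <= n)%N -> iter m f v = 0 -> iter n f v = 0.
Proof. by move=> /subnK <-; rewrite iterD => ->; rewrite iter_lfun0. Qed.

Lemma iter_lfun_comm f g n v :
  (forall u, f (g u) = g (f u)) -> iter n f (g v) = g (iter n f v).
Proof. by move=> fg; elim: n => //= n ->. Qed.

Lemma iter_lfun_uniform f U : (forall v, v \in U -> exists n, iter n f v = 0) ->
  exists n, forall v, v \in U -> iter n f v = 0.
Proof.
move=> nil.
have [N hN] : exists N : 'I_(\dim U) -> nat, forall i, iter (N i) f (vbasis U)`_i = 0.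
  have h (i : 'I_(\dim U)) : exists n, iter n f (vbasis U)`_i = 0.
    by apply: nil; apply: vbasis_mem; apply: mem_nth; rewrite size_tuple.
  by exists (fun i => sval (cid (h i))) => i; apply: (svalP (cid (h i))).
exists (\max_i N i)%N => v vU; rewrite (coord_vbasis vU).
rewrite (big_morph _ (iter_lfunD f _) (iter_lfun0 f _)) big1 // => i _.
by rewrite iter_lfunZ (iter_lfun_kill (leq_bigmax i)) ?scaler0.
Qed.

Lemma last_iter f U u : u \in U -> u != 0 ->
  (forall v, v \in U -> exists n, iter n f v = 0) ->
  exists m v, [/\ v \in U, iter m f v != 0 & forall w, w \in U -> iter m.+1 f w = 0].
Proof.
move=> uU u0 /iter_lfun_uniform.
case=> n; elim: n => [|n IHn] killU; first by rewrite -(killU u uU) eqxx in u0.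
have [/IHn //|/existsNP[v /not_implyP[vU /eqP vn]]] :=
  pselect (forall v, v \in U -> iter n f v = 0).
by exists n, v.
Qed.

Definition ltrace f : K := \tr (lin1_mx (v2r \o f \o r2v)).

Lemma lin1_lfun f u : u *m lin1_mx (v2r \o f \o r2v) = v2r (f (r2v u)).
Proof. exact: mul_rV_lin1. Qed.

Lemma ltrace_linear : linear (ltrace : 'End(V) -> K^o).
Proof.
move=> a f g; rewrite /ltrace -linearP; congr (\tr _); apply/matrixP => i j.
by rewrite !mxE /= add_lfunE scale_lfunE linearP !mxE.
Qed.

HB.instance Definition _ :=
  GRing.isLinear.Build K 'End(V) K^o *:%R ltrace ltrace_linear.

Lemma ltraceC f g : ltrace (f \o g) = ltrace (g \o f).
Proof.
have comp (h k : 'End(V)) : lin1_mx (v2r \o (h \o k)%VF \o r2v)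
    = lin1_mx (v2r \o k \o r2v) *m lin1_mx (v2r \o h \o r2v).
  apply/row_matrixP => i; rewrite !rowE mulmxA.
  rewrite !lin1_lfun v2rK.
  by rewrite comp_lfunE.
by rewrite /ltrace !comp mxtrace_mulC.
Qed.

End LinearOperators.

(** * Generalized eigenspaces *)

Section GeneralizedEigenspaces.
Variables (K : closedFieldType) (V : vectType K) (f : 'End(V)).
Implicit Types (a r mu : K) (u v w : V) (U W : {vspace V}).

Definition eshift mu : 'End(V) := (f - mu *: \1)%VF.

Lemma eshiftE mu v : eshift mu v = f v - mu *: v.
Proof. by rewrite add_lfunE opp_lfunE scale_lfunE id_lfunE. Qed.

Lemma eshift_comm mu v : eshift mu (f v) = f (eshift mu v).
Proof. by rewrite !eshiftE lfunB lfunZ. Qed.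

Fact ex_geigen mu :
  exists W : {vspace V}, forall v, v \in W <-> exists n, iter n (eshift mu) v = 0.
Proof.
apply: ex_vspace_pred => [|a u v [m um] [n vn]]; first by exists 0%N.
exists (m + n)%N; rewrite iter_linear [X in iter X _ u]addnC.
by rewrite !iterD um vn !iter_lfun0 scaler0 addr0.
Qed.

Definition geigen mu : {vspace V} := sval (cid (ex_geigen mu)).

Lemma geigenP mu v : v \in geigen mu <-> exists n, iter n (eshift mu) v = 0.
Proof. exact: (svalP (cid (ex_geigen mu))). Qed.

Lemma geigen_commute mu (g : 'End(V)) v : (forall u, f (g u) = g (f u)) ->
  v \in geigen mu -> g v \in geigen mu.
Proof.
move=> fg /geigenP[n vn]; apply/geigenP; exists n.
rewrite iter_lfun_comm ?vn ?linear0 // => u.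
by rewrite !eshiftE fg lfunB lfunZ.
Qed.

Lemma eshift_geigen mu r v : v \in geigen mu -> eshift r v \in geigen mu.
Proof. by apply: geigen_commute => u; rewrite eshift_comm. Qed.

Lemma geigen_eshift mu v : eshift mu v \in geigen mu -> v \in geigen mu.
Proof. by move=> /geigenP[n vn]; apply/geigenP; exists n.+1; rewrite iterSr. Qed.

Lemma eshift_geigen_surj mu r u : mu != r -> u \in geigen mu ->
  exists2 w, w \in geigen mu & eshift r w = u.
Proof.
move=> mur /geigenP[n]; elim: n u => [|n IHn] u.
  by move=> /= ->; exists 0; rewrite ?mem0v ?linear0.
rewrite iterSr => un; have [w wmu defw] := IHn _ un.
have umu : u \in geigen mu by apply/geigenP; exists n.+1; rewrite iterSr.
have nz : mu - r != 0 by rewrite subr_eq0.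
(* By induction [w] solves the equation for [eshift mu u], and [eshift r - eshift mu] is the scalar
   [mu - r]. *)
exists ((mu - r)^-1 *: (u - w)); first by rewrite memvZ ?memvB.
rewrite lfunZ lfunB defw.
suff -> : eshift r u - eshift mu u = (mu - r) *: u by rewrite scalerK.
by rewrite !eshiftE scalerBl opprB [_ - f u]addrC addrACA subrr add0r addrC.
Qed.

Lemma eshift_geigen_inj mu r n v : mu != r -> v \in geigen mu ->
  iter n (eshift r) v = 0 -> v = 0.
Proof.
move=> mur; elim: n v => // n IHn v vmu; rewrite iterSr => vn.
have {vn IHn} : eshift r v = 0 by apply: IHn => //; apply: eshift_geigen.
rewrite eshiftE => /eqP; rewrite subr_eq0 => /eqP fv.
have /geigenP[m] := vmu.
have -> : iter m (eshift mu) v = (r - mu) ^+ m *: v.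
  elim: m => [|m IHm]; first by rewrite scale1r.
  by rewrite iterS IHm lfunZ eshiftE fv -scalerBl scalerA exprSr.
move=> /eqP; rewrite scaler_eq0 expf_eq0 subr_eq0 eq_sym (negPf mur) andbF.
by move=> /eqP.
Qed.

Lemma geigen_disjoint mu r v : mu != r -> v \in geigen mu -> v \in geigen r -> v = 0.
Proof. by move=> mur vmu /geigenP[n]; apply: eshift_geigen_inj mur vmu. Qed.

(** A power of [eshift r] kills the component at [r] and is injective on the other generalized
    eigenspaces, so the relation shortens. *)
Lemma geigen_independent (s : seq K) (u : K -> V) : uniq s ->
  (forall mu, u mu \in geigen mu) -> \sum_(mu <- s) u mu = 0 ->
  forall mu, mu \in s -> u mu = 0.
Proof.
elim: s u => // r s IHs u /= /andP[rs us] uG; rewrite big_cons => sum0.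
have all0 mu : mu \in s -> u mu = 0.
  move=> mus; have [n un] : exists n, iter n (eshift r) (u r) = 0 by apply/geigenP.
  pose w mu := iter n (eshift r) (u mu).
  have w0 : w mu = 0.
    apply: IHs => // [nu|].
      by apply: iter_lfun_stable => // x; apply: eshift_geigen.
    have := congr1 (iter n (eshift r)) sum0.
    rewrite iter_lfunD un add0r iter_lfun0.
    by rewrite (big_morph _ (iter_lfunD (eshift r) n) (iter_lfun0 _ n)).
  apply: eshift_geigen_inj w0 => //.
  by apply: contraNneq rs => <-.
move=> mu; rewrite inE => /predU1P[->|/all0//].
by move: sum0; rewrite big_seq big1 ?addr0 // => i /all0.
Qed.

(** Primary decomposition. By [eshift_geigen_surj] the spaces for [mu != r] lie in the image of [W]
    under [eshift r], so [eshift r v] differs from some [eshift r w], [w] in [W], by an element of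
    [geigen r]; hence so does [v] from [w]. *)
Lemma foldl_eshift_sub (s : seq K) W v : foldl (fun u r => eshift r u) v s = 0 ->
  (forall r, r \in s -> geigen r <= W)%VS -> v \in W.
Proof.
elim: s v W => [|r s IHs] v W; first by move=> /= ->; rewrite mem0v.
move=> /= /IHs {IHs} IHs sW.
have sub : (geigen r <= W)%VS by rewrite sW ?mem_head.
have : eshift r v \in ((eshift r @: W) + geigen r)%VS.
  apply: IHs => mu mus; have [->|mur] := eqVneq mu r; first exact: addvSr.
  apply: subv_trans (addvSl _ _); apply/subvP => u umu.
  have [w wmu <-] := eshift_geigen_surj mur umu.
  by apply: memv_img; apply: subvP wmu; apply: sW; rewrite inE mus orbT.
case/memv_addP=> _ /memv_imgP[w wW ->] [u ur def_v].
rewrite -[v](subrK w) memvD // (subvP sub) // geigen_eshift //.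
by rewrite lfunB def_v addrC addKr.
Qed.

Lemma ex_spectrum : exists s : seq K,
  [/\ ltrace f = \sum_(r <- s) r,
      forall a, a \in s <-> exists2 v, v != 0 & f v = a *: v &
      forall v, foldl (fun u r => eshift r u) v s = 0].
Proof.
have [s [trs eigs kills]] := mx_split (lin1_mx (v2r \o f \o r2v)).
exists s; split=> // [a|v].
  rewrite eigs; split=> [/eigenvalueP[v]|[v v0 fv]].
    rewrite lin1_lfun => fv v0; exists (r2v v).
      by apply: contraNneq v0 => /(congr1 v2r); rewrite r2vK linear0 => ->.
    by apply: (can_inj v2rK); rewrite fv [RHS]linearZ /= r2vK.
  apply/eigenvalueP; exists (v2r v); first by rewrite lin1_lfun v2rK fv linearZ.
  by apply: contraNneq v0 => /(congr1 r2v); rewrite v2rK linear0 => ->.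
apply: (can_inj v2rK); rewrite linear0 -[RHS](kills (v2r v)).
elim: s v {trs eigs kills} => //= r s IHs v; rewrite IHs; congr foldl.
by rewrite eshiftE linearB linearZ /= mulmxBr lin1_lfun v2rK mul_mx_scalar.
Qed.

Lemma geigen_full W : (forall mu, geigen mu <= W)%VS -> W = fullv.
Proof.
move=> sW; apply/eqP; rewrite eqEsubv subvf; apply/subvP => v _.
by have [s [_ _ /(_ v)/foldl_eshift_sub]] := ex_spectrum; apply.
Qed.

Lemma geigen_ind (P : V -> Prop) : P 0 ->
    (forall a u v, P u -> P v -> P (a *: u + v)) ->
    (forall mu v, v \in geigen mu -> P v) -> forall v, P v.
Proof.
move=> P0 PD PG; have [W memW] := ex_vspace_pred P0 PD.
suff fullW : W = fullv by move=> v; apply/memW; rewrite fullW memvf.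
by apply: geigen_full => mu; apply/subvP => v /PG /memW.
Qed.

(** The factors of [ex_spectrum] are applied to a nonzero vector of [U] until the next one gives 0;
    the vector reached is an eigenvector. *)
Lemma ex_eigenvector U : (forall u, u \in U -> f u \in U) -> U != 0%VS ->
  exists a v, [/\ v \in U, v != 0 & f v = a *: v].
Proof.
move=> fU U0; have [s [_ _ /(_ (vpick U))]] := ex_spectrum.
have: vpick U != 0 by rewrite vpick0.
elim: s (vpick U) (memv_pick U) => [|r s IHs] v vU v0 /=.
  by move=> v00; rewrite v00 eqxx in v0.
have [fv0 _|fv0] := eqVneq (eshift r v) 0; last first.
  by apply: IHs => //; rewrite eshiftE memvB ?memvZ ?fU.
exists r, v; split=> //; apply/eqP; rewrite -subr_eq0 -eshiftE.
exact/eqP.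
Qed.

Lemma geigen_eigenvector mu v : v \in geigen mu -> v != 0 ->
  exists2 w, w != 0 & f w = mu *: w.
Proof.
move=> /geigenP[n]; elim: n v => [|n IHn] v; first by move=> /= ->; rewrite eqxx.
rewrite iterSr => vn v0.
have [fv0|] := eqVneq (eshift mu v) 0; last exact: IHn.
by exists v => //; apply/eqP; rewrite -subr_eq0 -eshiftE fv0.
Qed.

(** [D] is [phi] applied to the semisimple part of [f]. Two choices of [phi] matter later: complex
    conjugation, and the indicator of the scalars that are not nonnegative. *)
Lemma ex_diagonal (phi : K -> K) :
  exists D : 'End(V), forall mu v, v \in geigen mu -> D v = phi mu *: v.
Proof.
have [s [_ eigs kills]] := ex_spectrum.
have defV : fullv = (\sum_(mu <- undup s) geigen mu)%VS.
  apply/esym/eqP; rewrite eqEsubv subvf; apply/subvP => v _.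
  apply: foldl_eshift_sub (kills v) _ => r rs.
  have rs' : r \in undup s by rewrite mem_undup.
  by rewrite (big_rem r rs') addvSl.
pose p mu := sumv_pi_for defV mu.
have sum_p v : \sum_(mu <- undup s) p mu v = v.
  by apply: sumv_pi_uniq_sum; rewrite ?filter_predT ?undup_uniq ?memvf.
exists (\sum_(mu <- undup s) phi mu *: p mu) => mu v vmu.
have [->|v0] := eqVneq v 0; first by rewrite linear0 scaler0.
have mus : mu \in undup s.
  by rewrite mem_undup; apply/eigs; apply: geigen_eigenvector vmu v0.
pose u nu := p nu v - (if nu == mu then v else 0).
have uG nu : u nu \in geigen nu.
  rewrite memvB ?memv_sum_pi //; case: eqP => [->|_] //; exact: mem0v.
have u0 : \sum_(nu <- undup s) u nu = 0.
  rewrite sumrB sum_p -big_mkcond /= -big_filter filter_pred1_uniq ?undup_uniq //.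
  by rewrite big_seq1 subrr.
have pE nu : nu \in undup s -> p nu v = if nu == mu then v else 0.
  move=> nus; apply/eqP; rewrite -subr_eq0; apply/eqP.
  exact: (geigen_independent (undup_uniq s) uG u0 nus).
rewrite sum_lfunE (bigD1_seq mu) ?undup_uniq //= scale_lfunE pE // eqxx.
rewrite big_seq_cond big1 ?addr0 // => nu /andP[nus numu].
by rewrite scale_lfunE pE // (negPf numu) scaler0.
Qed.

End GeneralizedEigenspaces.

(** * Commutators and the centralizer of a minimal ideal *)

Section Adjoint.
Variables (K : numClosedFieldType) (L : lieAlgType K).
Implicit Types (x y u v w : L) (A B I J U W : {vspace L}).

Definition ad x : 'End(L) := linfun (lie_bracket x).

Lemma adE x y : ad x y = {[x, y]}. Proof. by rewrite lfunE. Qed.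

(** Leibniz rule for shifts: [ad x - (a + b)] acts on [[u, v]] through [ad x - a] on [u] and
    [ad x - b] on [v]. The induction is on the sum of the two exponents. *)
Lemma br_geigen x a b u v : u \in geigen (ad x) a -> v \in geigen (ad x) b ->
  {[u, v]} \in geigen (ad x) (a + b).
Proof.
move=> /geigenP[m um] /geigenP[n vn].
have [N] := ubnP (m + n)%N; elim: N m n u v um vn => // N IHN m n u v um vn.
case: m um => [|m] um; first by move: um => /= ->; rewrite br0l mem0v.
case: n vn => [|n] vn; first by move: vn => /= ->; rewrite br0r mem0v.
move=> ltN; apply: geigen_eshift.
have -> : eshift (ad x) (a + b) {[u, v]}
    = {[eshift (ad x) a u, v]} + {[u, eshift (ad x) b v]}.
  rewrite !eshiftE !adE br_jacobi brBl brBr brZl brZr scalerDl opprD.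
  by rewrite addrACA.
apply: memvD.
  apply: IHN vn _; first by rewrite -iterSr; apply: um.
  by rewrite -ltnS; move: ltN; rewrite addSn.
apply: (IHN m.+1) => //; first by rewrite -iterSr; apply: vn.
by rewrite -ltnS; move: ltN; rewrite !addnS.
Qed.

Section Commutator.
Variables (J : {vspace L}) (x a : L).
Hypotheses (aJ : forall v, v \in J -> {[a, v]} \in J)
  (caC : forall v, v \in J -> {[a, {[{[x, a]}, v]}]} = {[{[x, a]}, {[a, v]}]}).

(** With [b] the shift of [ad a], the commutator of [b] and [ad x] on [J] is [- ad [x, a]], which
    commutes with [b]; the formula is the rule for differentiating a power. *)
Lemma iter_eshift_bracket r n v : v \in J ->
  iter n.+1 (eshift (ad a) r) {[x, v]} = {[x, iter n.+1 (eshift (ad a) r) v]}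
    - n.+1%:R *: {[{[x, a]}, iter n (eshift (ad a) r) v]}.
Proof.
set b := eshift (ad a) r.
have bJ u : u \in J -> b u \in J.
  by move=> uJ; rewrite eshiftE adE memvB ?aJ // memvZ.
have bc m u : u \in J -> iter m b {[{[x, a]}, u]} = {[{[x, a]}, iter m b u]}.
  elim: m u => // m IHm u uJ; rewrite !iterSr -IHm ?bJ //; congr (iter m b _).
  by rewrite !eshiftE !adE caC // brBr brZr.
have b1 u : u \in J -> b {[x, u]} = {[x, b u]} - {[{[x, a]}, u]}.
  move=> uJ; rewrite !eshiftE !adE brBr brZr (br_jacobi x a u) addrAC.
  by rewrite [X in _ = X - _ - _]addrC addrK.
elim: n v => [|n IHn] v vJ; first by rewrite /= scale1r b1.
rewrite iterSr b1 // iter_lfunB bc // IHn ?bJ // -!iterSr.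
by rewrite -addrA -opprD -[X in - (_ + X)]scale1r -scalerDl natr1.
Qed.

(** Let [b ^ m] be the last nonzero power of the shift on a generalized eigenspace of [ad a] in [J].
    By [iter_eshift_bracket] this space also contains [[x, v]], which [b ^ m.+1] therefore kills;
    what remains of the formula is [m.+1] times [[[x, a], b ^ m v]], and [m.+1] is invertible. *)
Lemma commutator_kernel : (forall v, v \in J -> {[x, v]} \in J) -> J != 0%VS ->
  exists u, [/\ u \in J, u != 0 & {[{[x, a]}, u]} = 0].
Proof.
move=> xJ J0.
have [|r [v0 [v0J v00 av0]]] := @ex_eigenvector _ _ (ad a) J _ J0.
  by move=> u uJ; rewrite adE aJ.
have [||m [v [vU bv killU]]] := @last_iter _ _ (eshift (ad a) r)
  (J :&: geigen (ad a) r)%VS v0 _ v00.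
- rewrite memv_cap v0J; apply/geigenP; exists 1%N.
  by rewrite /= eshiftE av0 subrr.
- by move=> v; rewrite memv_cap => /andP[_ /geigenP].
have vJ : v \in J by move: vU; rewrite memv_cap => /andP[].
have bv0 := killU v vU.
have : {[x, v]} \in (J :&: geigen (ad a) r)%VS.
  rewrite memv_cap xJ //=; apply/geigenP; exists m.+2.
  by rewrite iter_eshift_bracket // bv0 iterS bv0 linear0 !br0r scaler0 subr0.
move=> /killU; rewrite iter_eshift_bracket // bv0 br0r sub0r.
move=> /eqP; rewrite oppr_eq0 scaler_eq0 pnatr_eq0 /= => /eqP cv0.
exists (iter m (eshift (ad a) r) v); split=> //.
by apply: iter_lfun_stable => // u uJ; rewrite eshiftE adE memvB ?memvZ ?aJ.
Qed.

End Commutator.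

(** By [iter_eshift_bracket], [ad x] raises the exponent of a generalized eigenvector by at most
    one. *)
Lemma geigen_ideal A J a r : lie_ideal fullv A -> lie_ideal fullv J ->
    (forall a b v, a \in A -> b \in A -> v \in J -> {[{[a, b]}, v]} = 0) ->
  a \in A -> lie_ideal fullv (J :&: geigen (ad a) r)%VS.
Proof.
move=> idA idJ AAJ aA; apply/lie_idealP; split=> [|x v _]; first exact: subvf.
rewrite !memv_cap => /andP[vJ /geigenP[n vn]]; rewrite ideal_brr //=.
apply/geigenP; exists n.+1; rewrite (@iter_eshift_bracket J) //.
- by rewrite iterS vn linear0 !br0r scaler0 subr0.
- by move=> u uJ; apply: ideal_brr.
- move=> u uJ; rewrite br_jacobi AAJ ?add0r //.
  exact: ideal_brr.
Qed.

Fact ex_lie_cent B :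
  exists W, forall v, v \in W <-> forall b, b \in B -> {[b, v]} = 0.
Proof.
apply: (ex_vspace_pred (P := fun v => forall b, b \in B -> {[b, v]} = 0)).
  by move=> b _; rewrite br0r.
by move=> r u v hu hv b bB; rewrite brDr brZr hu ?hv // scaler0 addr0.
Qed.

Definition lie_cent B := sval (cid (ex_lie_cent B)).

Lemma lie_centP B v : v \in lie_cent B <-> forall b, b \in B -> {[b, v]} = 0.
Proof. exact: (svalP (cid (ex_lie_cent B))). Qed.

Lemma lie_cent_ideal B : lie_ideal fullv B -> lie_ideal fullv (lie_cent B).
Proof.
move=> idB; apply/lie_idealP; split=> [|x v _ /lie_centP vB]; first exact: subvf.
apply/lie_centP => b bB; rewrite br_jacobi vB; last exact: ideal_brl.
by rewrite vB // br0r addr0.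
Qed.

Lemma sub_lie_centP A B :
  (A <= lie_cent B)%VS <-> forall a b, a \in A -> b \in B -> {[a, b]} = 0.
Proof.
split=> [/subvP sub a b aA bB|AB].
  by rewrite lie_bracketC; have /sub/lie_centP/(_ b bB)-> := aA; rewrite oppr0.
by apply/subvP => a aA; apply/lie_centP => b bB; rewrite lie_bracketC AB ?oppr0.
Qed.

(** In a stable subspace [W] of least positive dimension, an eigenspace of any [a] is again stable
    because [A] acts commutatively. So it is all of [W], and any nonzero vector of [W] serves. *)
Lemma common_eigenvector A J : J != 0%VS ->
    (forall a v, a \in A -> v \in J -> {[a, v]} \in J) ->
    (forall a b v, a \in A -> b \in A -> v \in J -> {[{[a, b]}, v]} = 0) ->
  exists w, [/\ w \in J, w != 0 & forall a, a \in A -> exists r, {[a, w]} = r *: w].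
Proof.
move=> J0 AJ AAJ.
pose P W := [/\ (W <= J)%VS, W != 0%VS &
  forall a v, a \in A -> v \in W -> {[a, v]} \in W].
pose d n := `[< exists W, P W /\ \dim W = n >].
have exd : exists n, d n by exists (\dim J); apply/asboolP; exists J; split.
case: (ex_minnP exd) => n /asboolP[W [[WJ W0 AW] dW]] minW.
exists (vpick W); split=> [||a aA].
- exact: subvP (memv_pick W).
- by rewrite vpick0.
have [|r [v [vW v0 av]]] := @ex_eigenvector _ _ (ad a) W _ W0.
  by move=> u uW; rewrite adE AW.
exists r; suff /eqP defW : (W :&: lker (eshift (ad a) r))%VS == W.
  have : vpick W \in (W :&: lker (eshift (ad a) r))%VS by rewrite defW memv_pick.
  by rewrite memv_cap memv_ker eshiftE adE subr_eq0 => /andP[_ /eqP].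
rewrite eqEdim capvSl dW; apply: minW; apply/asboolP.
exists (W :&: lker (eshift (ad a) r))%VS; split=> //; split.
- exact: subv_trans (capvSl _ _) WJ.
- apply: contraNneq v0 => cap0; rewrite -memv0 -cap0 memv_cap vW memv_ker.
  by rewrite eshiftE av subrr eqxx.
move=> b u bA; rewrite !memv_cap => /andP[uW]; rewrite AW //=.
rewrite !memv_ker !eshiftE !adE !subr_eq0 => /eqP au.
by rewrite br_jacobi AAJ ?add0r ?au ?brZr // (subvP WJ).
Qed.

Section MinimalIdeal.
Variable J : {vspace L}.
Hypotheses (idJ : lie_ideal fullv J) (J0 : J != 0%VS)
  (minJ : forall I, lie_ideal fullv I -> (I <= J)%VS -> I != 0%VS -> I = J).

Let memJ I v : lie_ideal fullv I -> v \in (J :&: I)%VS -> v != 0 -> (J <= I)%VS.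
Proof.
move=> idI vJI v0; apply/capv_idPl; apply: minJ; last 2 first.
- exact: capvSl.
- by apply: contraNneq v0 => cap0; rewrite -memv0 -cap0.
apply/lie_idealP; split=> [|x u _]; first exact: subvf.
by rewrite !memv_cap => /andP[uJ uI]; rewrite !ideal_brr.
Qed.

(** A commutator [c = [x, a]] has a kernel vector in [J], so [J :&: geigen (ad c) 0] is a nonzero
    ideal and equals [J]. The eigenvalue of [c] on a common eigenvector [w] is thus 0; since [w]
    centralizes [[L, A]], so does [J] by minimality. *)
Lemma minimal_ideal_abelian A : lie_ideal fullv A ->
  (lie_mul A A <= lie_cent J)%VS -> (lie_mul fullv A <= lie_cent J)%VS.
Proof.
move=> idA /sub_lie_centP cAA.
have AAJ a b v : a \in A -> b \in A -> v \in J -> {[{[a, b]}, v]} = 0.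
  by move=> aA bA vJ; apply: cAA => //; apply: mem_lie_mul.
have AJ a v : a \in A -> v \in J -> {[a, v]} \in J by move=> _; apply: ideal_brr.
have [w [wJ w0 Aw]] := common_eigenvector J0 AJ AAJ.
have wc : w \in lie_cent (lie_mul fullv A).
  apply/lie_centP; suff sub : (lie_mul fullv A <= lie_cent <[w]>)%VS.
    by move=> c cA; apply: (iffLR (sub_lie_centP _ _) sub) => //; apply: memv_line.
  apply/lie_mulP => x a _ aA; apply/lie_centP => _ /vlineP[k ->].
  have cA : {[x, a]} \in A by apply: ideal_brr.
  rewrite lie_bracketC brZr; suff -> : {[{[x, a]}, w]} = 0 by rewrite scaler0 oppr0.
  have [|||u [uJ u0 cu]] := @commutator_kernel J x a _ _ _ J0.
  - by move=> v; apply: AJ.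
  - by move=> v vJ; rewrite br_jacobi AAJ ?add0r.
  - by move=> v; apply: ideal_brr.
  have capJ : (J :&: geigen (ad {[x, a]}) 0)%VS = J.
    apply: minJ (capvSl _ _) _; first exact: geigen_ideal idA idJ AAJ cA.
    apply: contraNneq u0 => cap0; rewrite -memv0 -cap0 memv_cap uJ.
    by apply/geigenP; exists 1%N; rewrite /= eshiftE adE cu scale0r subrr.
  have [r cw] := Aw _ cA; rewrite cw.
  have [->|r0] := eqVneq r 0; first by rewrite scale0r.
  have w0c : w \in geigen (ad {[x, a]}) 0.
    by move: wJ; rewrite -capJ memv_cap => /andP[].
  case/eqP: w0; apply: geigen_disjoint r0 _ w0c.
  by apply/geigenP; exists 1%N; rewrite /= eshiftE adE cw subrr.
have sub : (J <= lie_cent (lie_mul fullv A))%VS.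
  apply: memJ w0; last by rewrite memv_cap wJ.
  by apply: lie_cent_ideal; apply: lie_ideal_mul => //; apply: lie_idealf.
apply/sub_lie_centP => c v cA vJ.
by have /lie_centP := subvP sub v vJ; apply.
Qed.

(** Schur's lemma: [[x, y]] acts on [J] commuting with [L], so its eigenspace is an ideal and the
    action is a scalar; [commutator_kernel] makes the scalar 0. *)
Lemma minimal_ideal_central_derived B :
    (lie_mul fullv (lie_mul B B) <= lie_cent J)%VS ->
  (lie_mul B B <= lie_cent J)%VS.
Proof.
move=> /sub_lie_centP cLB; apply/lie_mulP => x y xB yB.
have aJ v : v \in J -> {[{[x, y]}, v]} \in J by apply: ideal_brr.
have [|r [v0 [v0J v00 av0]]] := @ex_eigenvector _ _ (ad {[x, y]}) J _ J0.
  by move=> u; rewrite adE; apply: aJ.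
have cap_ideal : lie_ideal fullv (J :&: lker (eshift (ad {[x, y]}) r))%VS.
  apply/lie_idealP; split=> [|z u _]; first exact: subvf.
  rewrite !memv_cap => /andP[uJ]; rewrite ideal_brr //=.
  rewrite !memv_ker !eshiftE !adE !subr_eq0 => /eqP au.
  rewrite br_jacobi au brZr cLB ?add0r //.
  by rewrite lie_mulC mem_lie_mul ?memvf // mem_lie_mul.
have actJ v : v \in J -> {[{[x, y]}, v]} = r *: v.
  suff <- : (J :&: lker (eshift (ad {[x, y]}) r))%VS = J.
    by rewrite memv_cap memv_ker eshiftE adE subr_eq0 => /andP[_ /eqP].
  apply: minJ (capvSl _ _) _ => //.
  apply: contraNneq v00 => cap0; rewrite -memv0 -cap0 memv_cap v0J memv_ker.
  by rewrite eshiftE av0 subrr eqxx.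
have [|||u [uJ u0 cu]] := @commutator_kernel J x y _ _ _ J0.
- by move=> v; apply: ideal_brr.
- by move=> v vJ; rewrite !actJ ?brZr // ideal_brr.
- by move=> v; apply: ideal_brr.
apply/lie_centP => v vJ; rewrite lie_bracketC actJ //.
move: cu; rewrite actJ // => /eqP; rewrite scaler_eq0 (negPf u0) orbF => /eqP->.
by rewrite scale0r oppr0.
Qed.

(** Climbs the derived series of [A] from 0: if [[L, A_(k+1)]] kills [J], so does [A_(k+1) =
    [A_k, A_k]], and then so does [[L, A_k]]. *)
Lemma minimal_ideal_solvable A : lie_ideal fullv A -> lie_solvable A ->
  (lie_mul fullv A <= lie_cent J)%VS.
Proof.
move=> idA [n /eqP An0].
have subC k : (lie_mul fullv (lie_derived A k) <= lie_cent J)%VS ->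
    (lie_mul fullv A <= lie_cent J)%VS.
  elim: k => [//|k IHk] /minimal_ideal_central_derived hk; apply: IHk.
  by apply: minimal_ideal_abelian => //; apply: lie_derived_ideal.
by apply: (subC n); rewrite An0 lie_mulv0 sub0v.
Qed.

End MinimalIdeal.

End Adjoint.

(** * Nilpotency of [L, R] for solvable R, and Engel's theorem *)

Section SolvableIdeals.
Variables (K : numClosedFieldType) (L : lieAlgType K).
Implicit Types (x y u v w : L) (A B H I J U V W : {vspace L}).

(** For [I] maximal among the ideals properly inside [J], the quotient [J/I] is a minimal ideal of
    [L/I]; so [[L, A]] kills it and maps [J] into [I]. *)
Lemma commutator_solvable_shrinks A J : lie_ideal fullv A -> lie_solvable A ->
  lie_ideal fullv J -> J != 0%VS -> lie_mul (lie_mul fullv A) J != J.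
Proof.
move=> idA solA idJ J0.
pose P I := lie_ideal fullv I && (I <= J)%VS.
have [|||I [[/andP[idI IJ] IneJ maxI] _]] := @ex_maximal_proper _ _ P J 0%VS.
- by move=> N /andP[].
- by rewrite /P lie_ideal0 sub0v.
- by rewrite eq_sym.
have [Q [p [s [pbr sK ker_p]]]] := ex_lie_quotient idI.
suff /sub_lie_centP AJ : (lie_mul fullv (p @: A) <= lie_cent (p @: J))%VS.
  apply: contraNneq IneJ => eqJ; rewrite eqEsubv IJ -eqJ.
  apply/lie_mulP => c v cA vJ; rewrite -ker_p pbr AJ ?memv_img ?eqxx //.
  by rewrite -(img_full sK) -img_lie_mul // memv_img.
apply: minimal_ideal_solvable.
- exact: img_ideal.
- apply: contraNneq IneJ => pJ0; rewrite eqEsubv IJ; apply/subvP => v vJ.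
  by rewrite -ker_p -memv0 -pJ0 memv_img.
- move=> M idM MJ M0.
  have kJ : (lker p <= J)%VS.
    by apply: subv_trans IJ; apply/subvP => v; rewrite memv_ker ker_p.
  have NJ : (p @^-1: M <= J)%VS by rewrite -(preim_img kJ) lpreimS.
  have [<-|NneJ] := eqVneq (p @^-1: M)%VS J; first by rewrite (img_preim sK).
  case/eqP: M0; rewrite -(img_preim sK M) (maxI (p @^-1: M)%VS) //.
  - apply/eqP; rewrite -subv0; apply/subvP => _ /memv_imgP[v vI ->].
    by rewrite memv0 ker_p.
  - by rewrite /P NJ preim_ideal.
  by apply/subvP => v; rewrite -ker_p -memv_preim => /eqP->; rewrite mem0v.
- exact: img_ideal.
- exact: img_lie_solvable.
Qed.

(** Each term of the lower central series is an ideal of [L], so by [commutator_solvable_shrinks]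
    the dimensions drop until 0. *)
Lemma commutator_solvable_nilpotent A : lie_ideal fullv A -> lie_solvable A ->
  lie_nilpotent (lie_mul fullv A).
Proof.
move=> idA solA; set C := lie_mul fullv A.
have idC : lie_ideal fullv C by apply: lie_ideal_mul => //; apply: lie_idealf.
have idlc n : lie_ideal fullv (lie_lower_central C n).
  by elim: n => //= n IHn; apply: lie_ideal_mul.
have lcS n : (lie_lower_central C n.+1 <= lie_lower_central C n)%VS.
  by apply/lie_mulP => u v uC _; apply: ideal_brl.
suff [n n0] : exists n, \dim (lie_lower_central C n) = 0%N.
  by exists n; rewrite -dimv_eq0 n0.
suff IH m : forall k, (\dim (lie_lower_central C k) <= m)%N ->
    exists n, \dim (lie_lower_central C n) = 0%N.
  by apply: (IH (\dim C) 0%N).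
elim: m => [|m IHm] k.
  by exists k; apply/eqP; rewrite -leqn0.
have [k0 _|k0 lek] := eqVneq (lie_lower_central C k) 0%VS.
  by exists k; rewrite k0 dimv0.
apply: (IHm k.+1); rewrite -ltnS; apply: leq_trans lek; rewrite ltnNge.
apply: contra (commutator_solvable_shrinks idA solA (idlc k) k0) => le.
by rewrite -/C lie_mulC eqEdim (lcS k).
Qed.

(** Engel's theorem; [geigen (ad b) 0 = fullv] says that [ad b] is nilpotent. The relative form lets
    the induction apply to a maximal subalgebra [H] acting both on [B] modulo [H] and on [V] modulo
    [U]. *)
Lemma engel_null_vector B U V : lie_subalgebra fullv B ->
    (forall b, b \in B -> geigen (ad b) 0 = fullv) ->
    (U <= V)%VS -> U != V ->
    (forall b v, b \in B -> v \in V -> {[b, v]} \in V) ->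
    (forall b u, b \in B -> u \in U -> {[b, u]} \in U) ->
  exists2 v, (v \in V) && (v \notin U) & forall b, b \in B -> {[b, v]} \in U.
Proof.
have [N] := ubnP (\dim B); elim: N B U V => // N IHN B U V ltBN.
move=> sB nilB UV neUV BV BU.
have exV : exists2 v, v \in V & v \notin U.
  apply/subvPn; apply: contra neUV => VU; by rewrite eqEsubv UV.
have [B0|B0] := eqVneq B 0%VS.
  have [v vV vU] := exV; exists v; first by rewrite vV.
  by move=> b; rewrite B0 memv0 => /eqP->; rewrite br0l mem0v.
have [|||H [[/andP[HB HH] HneB maxH] _]] :=
  @ex_maximal_proper _ _ (lie_subalgebra B) B 0%VS.
- by move=> M /andP[].
- by rewrite /lie_subalgebra lie_mulv0 !sub0v.
- by rewrite eq_sym.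
have sH : lie_subalgebra fullv H by rewrite /lie_subalgebra subvf.
have hB b : b \in H -> b \in B by apply: subvP.
have ltHN : (\dim H < N)%N.
  rewrite -ltnS; apply: leq_trans ltBN; rewrite ltnS ltnNge.
  by apply: contra HneB => le; rewrite eqEdim HB.
have [_ mulH] := lie_subalgebraP _ _ sH.
have [_ mulB] := lie_subalgebraP _ _ sB.
have [|||z /andP[zB zH] Hz] := IHN H H B ltHN sH _ HB HneB.
- by move=> b /hB; apply: nilB.
- by move=> b v /hB; apply: mulB.
- by move=> b v; apply: mulH.
(* [z] normalizes [H], so [H + <[z]>] is a subalgebra, and maximality of [H] makes it [B]. *)
have defB : (H + <[z]>)%VS = B.
  apply/eqP; apply: contraT => neB.
  case/negP: zH; suff <- : (H + <[z]>)%VS = H.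
    by rewrite (subvP (addvSr _ _)) // memv_line.
  apply: maxH => //; last exact: addvSl.
  rewrite /lie_subalgebra subv_add HB -memvE zB; apply/lie_mulP.
  move=> _ w /memv_addP[a aH [_ /vlineP[k ->] ->]].
  move=> /memv_addP[b bH [_ /vlineP[l ->] ->]].
  apply: (subvP (addvSl _ _)); rewrite brDl !brDr !brZl !brZr lie_alternating.
  rewrite !scaler0 addr0 [{[z, b]}]lie_bracketC scalerN.
  apply: memvB; last exact/memvZ/Hz.
  apply: memvD; first exact: mulH.
  exact/memvZ/Hz.
have [|||v /andP[vV vU] Hv] := IHN H U V ltHN sH _ UV neUV.
- by move=> b /hB; apply: nilB.
- by move=> b v /hB; apply: BV.
- by move=> b v /hB; apply: BU.
have : v \in geigen (ad z) 0 by rewrite nilB ?memvf.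
(* [z] is applied to [v] as long as the result stays outside [U]; by [Hz], [H] still maps the result
   into [U]. *)
case/geigenP=> n; elim: n v vV vU Hv => [|n IHn] v vV vU Hv.
  by move=> /= v0; rewrite v0 mem0v in vU.
rewrite iterSr eshiftE scale0r subr0 adE => vn.
have [zvU|zvU] := boolP ({[z, v]} \in U); last first.
  apply: IHn vn => // [|b bH]; first exact: BV.
  by rewrite br_jacobi memvD // ?Hv ?Hz // BU // Hv.
exists v; rewrite ?vV // => b; rewrite -defB => /memv_addP[h hH [_ /vlineP[k ->] ->]].
by rewrite brDl brZl; apply: memvD; [apply: Hv | apply: memvZ].
Qed.

Lemma engel_center B : lie_ideal fullv B ->
    (forall b, b \in B -> geigen (ad b) 0 = fullv) -> B != 0%VS ->
  (B :&: lie_cent B)%VS != 0%VS.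
Proof.
move=> idB nilB B0.
have [||||||v /andP[vB]] := @engel_null_vector B 0%VS B.
- exact: ideal_subalgebra.
- exact: nilB.
- exact: sub0v.
- by rewrite eq_sym.
- by move=> b v _; apply: ideal_brr.
- by move=> b u _; rewrite memv0 => /eqP->; rewrite br0r mem0v.
rewrite memv0 => v0 cv; apply: contraNneq v0 => cap0.
rewrite -memv0 -cap0 memv_cap vB; apply/lie_centP => b bB.
by apply/eqP; rewrite -memv0 cv.
Qed.

End SolvableIdeals.

(** * The Killing form *)

Section Killing.
Variables (K : numClosedFieldType) (L : lieAlgType K).
Implicit Types (x y z u v w : L) (A B H I J U V W : {vspace L}) (D : 'End(L)).

Lemma ltraceB (f g : 'End(L)) : ltrace (f - g) = ltrace f - ltrace g.
Proof. exact: raddfB. Qed.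

Lemma ltrace_commutator (f g h : 'End(L)) :
  ltrace (((f \o g) - (g \o f)) \o h)%VF
    = ltrace (f \o ((g \o h) - (h \o g)))%VF.
Proof.
rewrite comp_lfunDl comp_lfunNl comp_lfunDr comp_lfunNr !ltraceB.
by rewrite !comp_lfunA -[(g \o f \o h)%VF]comp_lfunA (ltraceC g).
Qed.

Lemma ad_bracket x y : ad {[x, y]} = ((ad x \o ad y) - (ad y \o ad x))%VF.
Proof.
apply/lfunP => z; rewrite add_lfunE opp_lfunE !comp_lfunE !adE.
by rewrite br_jacobi addrK.
Qed.

Lemma ad_linear : linear (@ad K L).
Proof.
move=> a x y; apply/lfunP => z.
by rewrite add_lfunE scale_lfunE !adE brDl brZl.
Qed.

Definition killing x y : K := ltrace (ad x \o ad y).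

Lemma killing_linear x : linear (killing x : L -> K^o).
Proof.
move=> a y z; rewrite /killing ad_linear comp_lfunDr -comp_lfunZr.
exact: ltrace_linear.
Qed.

HB.instance Definition _ x :=
  GRing.isLinear.Build K L K^o *:%R (killing x) (killing_linear x).

Lemma killingC x y : killing x y = killing y x.
Proof. exact: ltraceC. Qed.

Lemma killingDl x y z : killing (x + y) z = killing x z + killing y z.
Proof. by rewrite !(killingC _ z) raddfD. Qed.

Lemma killingBl x y z : killing (x - y) z = killing x z - killing y z.
Proof. by rewrite !(killingC _ z) raddfB. Qed.

Lemma killingZl a x z : killing (a *: x) z = a * killing x z.
Proof. by rewrite !(killingC _ z) linearZ. Qed.

Lemma killing_bracket x y z : killing {[x, y]} z = killing x {[y, z]}.
Proof. by rewrite /killing !ad_bracket ltrace_commutator. Qed.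

Fact ex_killing_perp I :
  exists W, forall x, x \in W <-> forall y, y \in I -> killing y x = 0.
Proof.
apply: (ex_vspace_pred (P := fun x => forall y, y \in I -> killing y x = 0)).
  by move=> y _; rewrite linear0.
by move=> a u v hu hv y yI; rewrite linearP /= hu ?hv // scaler0 addr0.
Qed.

Definition killing_perp I := sval (cid (ex_killing_perp I)).

Lemma killing_perpP I x : x \in killing_perp I <-> forall y, y \in I -> killing y x = 0.
Proof. exact: (svalP (cid (ex_killing_perp I))). Qed.

Lemma killing_perp_ideal I : lie_ideal fullv I -> lie_ideal fullv (killing_perp I).
Proof.
move=> idI; apply/lie_idealP; split=> [|x v _ /killing_perpP vI]; first exact: subvf.
apply/killing_perpP => y yI; rewrite -killing_bracket.
by apply: vI; apply: ideal_brl.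
Qed.

Definition derivation D := forall x y, D {[x, y]} = {[D x, y]} + {[x, D y]}.

Lemma ad_derivation D x : derivation D -> ad (D x) = ((D \o ad x) - (ad x \o D))%VF.
Proof.
move=> derD; apply/lfunP => y.
by rewrite add_lfunE opp_lfunE !comp_lfunE !adE derD addrK.
Qed.

(** Additivity of [phi] matches the addition of eigenvalues under brackets in [br_geigen]. *)
Lemma diagonal_derivation (phi : {additive K -> K}) x D :
  (forall mu v, v \in geigen (ad x) mu -> D v = phi mu *: v) -> derivation D.
Proof.
move=> defD u v; move: u; apply: (@geigen_ind _ _ (ad x)) => [|k u w Du Dw|a u ua].
- by rewrite br0l linear0 !br0l addr0.
- rewrite brDl brZl lfun_linear Du Dw lfun_linear !brDl !brZl scalerDr.
  by rewrite addrACA.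
move: v; apply: (@geigen_ind _ _ (ad x)) => [|k v w Dv Dw|b v vb].
- by rewrite !br0r linear0 br0r addr0.
- by rewrite brDr brZr lfun_linear Dv Dw lfun_linear !brDr !brZr scalerDr addrACA.
rewrite (defD _ _ (br_geigen ua vb)) (defD _ _ ua) (defD _ _ vb).
by rewrite brZl brZr -scalerDl raddfD.
Qed.

(* If D multiplies the generalized eigenvectors of ad x by the conjugate of
   their eigenvalue mu, then ad x \o D has the eigenvalues |mu|^2. *)
Lemma killing_radical_nilpotent x : x \in lie_mul (killing_perp fullv) fullv ->
  geigen (ad x) 0 = fullv.
Proof.
move=> xI; have [D defD] := ex_diagonal (ad x) Num.conj.
have derD : derivation D by apply: diagonal_derivation defD.
pose T := (ad x \o D)%VF.
(* For [x = [a, b]] with [a] orthogonal to [L], the trace equals [- killing a (D b)]. *)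
have trT : ltrace T = 0.
  have [W memW] : exists W, forall y, y \in W <-> ltrace (ad y \o D) = 0.
    apply: (ex_vspace_pred (P := fun y => ltrace (ad y \o D) = 0)) => [|a u v].
      have -> : ad 0 = 0 :> 'End(L) by apply/lfunP => y; rewrite adE br0l zero_lfunE.
      by rewrite comp_lfun0l raddf0.
    rewrite ad_linear comp_lfunDl -comp_lfunZl ltrace_linear => -> ->.
    by rewrite scaler0 addr0.
  apply/memW; apply: subvP xI; apply/lie_mulP => a b /killing_perpP aK _.
  apply/memW; rewrite ad_bracket ltrace_commutator.
  rewrite -[(_ - _)%VF]opprB -ad_derivation // comp_lfunNr raddfN /=.
  by rewrite -/(killing _ _) killingC aK ?memvf ?oppr0.
have T_eigen mu v : v \in geigen (ad x) mu -> v \in geigen T (mu^* * mu).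
  case/geigenP=> n; elim: n v => [|n IHn] v; first by move=> /= ->; rewrite mem0v.
  move=> vn; have vmu : v \in geigen (ad x) mu by apply/geigenP; exists n.+1.
  apply: geigen_eshift; have -> : eshift T (mu^* * mu) v = mu^* *: eshift (ad x) mu v.
    by rewrite !eshiftE comp_lfunE (defD _ _ vmu) lfunZ scalerBr scalerA.
  by rewrite memvZ // IHn // -iterSr.
have [s [trs eigs _]] := ex_spectrum T.
have s_ge0 r : r \in s -> 0 <= r.
  case/eigs=> w w0 Tw.
  (* [E] detects eigenvalues of [T] that are not nonnegative; it vanishes because the generalized
     eigenvectors of [ad x] span and belong to values [mu^* * mu] of [T]. *)
  have [E defE] := ex_diagonal T (fun t => if 0 <= t then 0 else 1).
  have E0 : forall v, E v = 0.
    apply: (@geigen_ind _ _ (ad x)) => [|a u v Eu Ev|mu v /T_eigen vT].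
    - exact: linear0.
    - by rewrite lfun_linear Eu Ev scaler0 addr0.
    - by rewrite (defE _ _ vT) mulrC mul_conjC_ge0 scale0r.
  have /defE : w \in geigen T r.
    by apply/geigenP; exists 1%N; rewrite /= eshiftE Tw subrr.
  rewrite E0; case: ifP => // _ /eqP; rewrite scale1r eq_sym => w00.
  by rewrite w00 in w0.
have s0 r : r \in s -> r = 0.
  move=> rs; have /eqP := esym trs; rewrite trT big_seq psumr_eq0 // => /allP/(_ r rs).
  by rewrite rs => /eqP.
apply: geigen_full => mu; have [->|mu0] := eqVneq mu 0; first exact: subvv.
apply/subvP => v vmu; have [->|v0] := eqVneq v 0; first exact: mem0v.
have [w w0 xw] := geigen_eigenvector vmu v0.
have wmu : w \in geigen (ad x) mu.
  by apply/geigenP; exists 1%N; rewrite /= eshiftE xw subrr.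
case/eqP: mu0; apply/eqP; rewrite -mul_conjC_eq0; apply/eqP; apply: s0.
by apply/eigs; exists w => //; rewrite comp_lfunE (defD _ _ wmu) lfunZ xw scalerA mulrC.
Qed.

(** Equivalent to a zero radical; the form with abelian ideals is directly testable on intersections
    such as [I :&: killing_perp I]. *)
Definition lie_semisimple :=
  forall I, lie_ideal fullv I -> lie_mul I I = 0%VS -> I = 0%VS.

(** Nondegeneracy on [W] makes the Gram matrix [G] of a basis invertible. The relative form serves
    for ideals and for the whole algebra. *)
Lemma killing_riesz W (f : {linear L -> K^o}) :
    (forall w, w \in W -> (forall v, v \in W -> killing w v = 0) -> w = 0) ->
  exists2 w, w \in W & forall v, v \in W -> killing w v = f v.
Proof.
move=> ndW; pose e := vbasis W.
pose G : 'M[K]_(\dim W) := \matrix_(i, j) killing e`_i e`_j.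
pose lin (c : 'rV[K]_(\dim W)) := \sum_i c 0 i *: e`_i.
have eW (i : 'I_(\dim W)) : e`_i \in W.
  by apply: vbasis_mem; apply: mem_nth; rewrite size_tuple.
have linW c : lin c \in W by apply: memv_suml => i _; rewrite memvZ.
have linG c (j : 'I_(\dim W)) : killing (lin c) e`_j = (c *m G) 0 j.
  rewrite killingC linear_sum mxE; apply: eq_bigr => i _.
  by rewrite linearZ /= killingC mxE.
have expand (g : {linear L -> K^o}) v : v \in W ->
    g v = \sum_(j < \dim W) coord e j v *: g e`_j.
  move=> vW; rewrite {1}(coord_vbasis vW) linear_sum; apply: eq_bigr => j _.
  by rewrite linearZ.
have Gunit : G \in unitmx.
  rewrite -row_free_unit -kermx_eq0; apply/eqP/row_matrixP => i.
  set c := row i _; have cG : c *m G = 0 by rewrite /c -row_mul mulmx_ker row0.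
  have c0 : lin c = 0.
    apply: ndW => // v vW; rewrite (expand (killing (lin c))) // big1 // => j _.
    by rewrite /= linG cG mxE scaler0.
  rewrite row0; apply/rowP => j; rewrite [RHS]mxE.
  have /freeP := basis_free (vbasisP W); apply.
  exact: c0.
pose c := (\row_j f e`_j) *m invmx G; exists (lin c) => // v vW.
rewrite (expand (killing (lin c))) // (expand f) //; apply: eq_bigr => j _.
by rewrite /= linG /c mulmxKV // mxE.
Qed.

Hypothesis ssL : lie_semisimple.

Lemma semisimple_nil_ideal B : lie_ideal fullv B ->
  (forall b, b \in B -> geigen (ad b) 0 = fullv) -> B = 0%VS.
Proof.
move=> idB nilB; apply/eqP; apply: contraT => /(engel_center idB nilB)/eqP[].
apply: ssL.
  apply/lie_idealP; split=> [|z v _]; first exact: subvf.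
  by rewrite !memv_cap => /andP[vB vC]; rewrite !ideal_brr ?lie_cent_ideal.
apply/eqP; rewrite -subv0; apply/lie_mulP => u v.
by rewrite !memv_cap memv0 => /andP[uB _] /andP[_ /lie_centP->].
Qed.

(** With [I] the radical of the form, [[I, L]] consists of ad-nilpotent elements and is 0 by Engel's
    theorem, so [I] is an abelian ideal. *)
Lemma killing_nondegenerate x : (forall y, killing y x = 0) -> x = 0.
Proof.
move=> kx; pose I := killing_perp fullv.
have idI : lie_ideal fullv I by apply/killing_perp_ideal/lie_idealf.
have idB : lie_ideal fullv (lie_mul I fullv).
  by apply: lie_ideal_mul => //; apply: lie_idealf.
have B0 : lie_mul I fullv = 0%VS.
  by apply: semisimple_nil_ideal => // b; apply: killing_radical_nilpotent.
apply/eqP; rewrite -memv0 -(ssL idI); first by apply/killing_perpP => y _.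
by apply/eqP; rewrite -subv0 -B0 lie_mulS ?subvf.
Qed.

(** Invariance makes the intersection abelian: for [x], [y] in it, [killing [x, y] z = killing x
    [y, z]], and [[y, z]] lies in [I]. *)
Lemma killing_perp_cap I : lie_ideal fullv I -> (I :&: killing_perp I)%VS = 0%VS.
Proof.
move=> idI; have idP := killing_perp_ideal idI; apply: ssL.
  apply/lie_idealP; split=> [|z v _]; first exact: subvf.
  by rewrite !memv_cap => /andP[vB vC]; rewrite !ideal_brr.
apply/eqP; rewrite -subv0; apply/lie_mulP => x y.
rewrite !memv_cap memv0 => /andP[_ /killing_perpP xI] /andP[yI _].
apply/eqP/killing_nondegenerate => z; rewrite killingC killing_bracket killingC.
by apply: xI; apply: ideal_brl.
Qed.

Lemma killing_perp_compl I : lie_ideal fullv I -> (I + killing_perp I)%VS = fullv.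
Proof.
move=> idI; apply/eqP; rewrite eqEsubv subvf; apply/subvP => x _.
have [w wI|w wI defw] := @killing_riesz I (killing x).
  move=> wI'; apply/eqP; rewrite -memv0 -(killing_perp_cap idI) memv_cap wI.
  by apply/killing_perpP => y yI; rewrite killingC wI'.
rewrite -[x](subrK w) addrC memv_add //; apply/killing_perpP => y yI.
by rewrite killingC killingBl defw // subrr.
Qed.

(** [u] represents the form [x |-> tr (D ad x)]; then [killing [u, x] y = tr (D ad [x, y]) = tr
    ([D, ad x] ad y) = killing (D x) y]. *)
Lemma derivation_inner D : derivation D -> exists u, forall x, D x = {[u, x]}.
Proof.
move=> derD.
have trD_linear : linear (fun x => ltrace (D \o ad x) : K^o).
  by move=> a x y; rewrite ad_linear comp_lfunDr -comp_lfunZr ltrace_linear.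
pose f : {linear L -> K^o} := HB.pack (fun x => ltrace (D \o ad x) : K^o)
  (GRing.isLinear.Build K L K^o *:%R _ trD_linear).
have [w _ wK|u _ defu] := @killing_riesz fullv f.
  by apply: killing_nondegenerate => y; rewrite killingC wK ?memvf.
exists u => x; apply/eqP; rewrite -subr_eq0; apply/eqP/killing_nondegenerate => y.
rewrite raddfB /= [killing y {[u, x]}]killingC killing_bracket defu ?memvf //.
rewrite /killing ad_derivation // ltraceC ltrace_commutator -ad_bracket.
by rewrite /f /= subrr.
Qed.

End Killing.

Lemma ex_separating_functional (K : fieldType) (V : vectType K) (W : {vspace V}) z :
  z \notin W ->
  exists f : {linear V -> K^o}, (forall w, w \in W -> f w = 0) /\ f z != 0.
Proof.
move=> zW; pose c i v : K^o := coord (vbasis fullv) i (v - projv W v).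
have c_linear i : linear (c i).
  by move=> a u v; rewrite /c lfun_linear opprD addrACA -scalerBr linearP.
pose f i : {linear V -> K^o} := HB.pack (c i)
  (GRing.isLinear.Build K V K^o *:%R _ (c_linear i)).
have [i ci] : exists i, c i z != 0.
  apply: contrapT => /forallNP all0; case/negP: zW.
  suff /eqP : z - projv W z = 0 by rewrite subr_eq0 => /eqP->; apply: memv_proj.
  rewrite (coord_vbasis (memvf (z - projv W z))) big1 // => i _.
  by have /negP/negPn/eqP := all0 i; rewrite /c => ->; rewrite scale0r.
exists (f i); split=> // w wW.
by rewrite /f /= /c projv_id // subrr linear0.
Qed.

(** * The quotient by the radical *)

Section Radical.
Variables (K : numClosedFieldType) (L Q : lieAlgType K).
Variables (p : 'Hom(L, Q)) (s : 'Hom(Q, L)).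
Hypotheses (pbr : forall x y, p {[x, y]} = {[p x, p y]}) (sK : cancel s p).
Hypothesis ker_p : forall v, (p v == 0) = (v \in lie_radical L).

(** The preimage of an abelian ideal has its derived algebra in the radical, so it is a solvable
    ideal. *)
Lemma radical_quotient_semisimple : lie_semisimple Q.
Proof.
move=> M idM MM0; have [[idR solR] maxR] := lie_radicalP L.
have sub : (p @^-1: M <= lie_radical L)%VS.
  apply: maxR; split; first exact: preim_ideal.
  case: solR => n /eqP Rn0; exists n.+1; rewrite -lie_derived1 -subv0 -Rn0.
  apply: lie_derivedS; apply/lie_mulP => u v; rewrite -!memv_preim => uM vM.
  by rewrite -ker_p pbr -memv0 -MM0 mem_lie_mul.
apply/eqP; rewrite -subv0 -(img_preim sK M); apply/subvP => _ /memv_imgP[v vM ->].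
by rewrite memv0 ker_p (subvP sub).
Qed.

Let ssQ := radical_quotient_semisimple.

Let mem_comr x r : r \in lie_radical L -> {[x, r]} \in commutator_radical L.
Proof. by move=> rR; rewrite mem_lie_mul ?memvf. Qed.

Let mem_coml x r : r \in lie_radical L -> {[r, x]} \in commutator_radical L.
Proof. by move=> rR; rewrite lie_bracketC memvN mem_comr. Qed.

(* A functional f killing [L, rad L] yields a derivation D of Q with
   f [x, y] = killing (D x) y, which is inner; hence f factors through Q on
   [L, L]. *)
Lemma derived_cap_radical :
  (lie_mul fullv fullv :&: lie_radical L <= commutator_radical L)%VS.
Proof.
apply/subvP => z; rewrite memv_cap => /andP[zLL zR]; apply/negPn/negP => zK.
have [f [fK fz]] := ex_separating_functional zK.
have ndQ w : w \in {:Q}%VS -> (forall v, v \in {:Q}%VS -> killing w v = 0) -> w = 0.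
  move=> _ hw; apply: (killing_nondegenerate ssQ) => y.
  by rewrite killingC hw ?memvf.
have exd q : exists u, forall y, killing u y = f {[s q, s y]}.
  have g_linear : linear (fun y => f {[s q, s y]} : K^o).
    by move=> a x y; rewrite lfun_linear brDr brZr linearP.
  pose g : {linear Q -> K^o} := HB.pack (fun y => f {[s q, s y]} : K^o)
    (GRing.isLinear.Build K Q K^o *:%R _ g_linear).
  have [u _ hu] := killing_riesz g ndQ; exists u => y.
  by rewrite hu ?memvf.
pose d q := sval (cid (exd q)).
have dE q y : killing (d q) y = f {[s q, s y]} by apply: (svalP (cid (exd q))).
have d_linear : linear d.
  move=> a x y; apply/eqP; rewrite -subr_eq0; apply/eqP/(ndQ _ (memvf _)) => v _.
  rewrite killingBl killingDl killingZl !dE lfun_linear brDl brZl linearP.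
  exact: subrr.
pose dl : {linear Q -> Q} := HB.pack d (GRing.isLinear.Build K Q Q *:%R _ d_linear).
pose D := linfun dl.
(* [f] kills [[L, rad L]], so the representatives chosen by [s] can be replaced by any others. *)
have DE x y : killing (D (p x)) (p y) = f {[x, y]}.
  rewrite /D lfunE /= dE; apply/eqP; rewrite eq_sym -subr_eq0 -linearB /=.
  have spR v : v - s (p v) \in lie_radical L.
    by rewrite -ker_p lfunB sK subrr.
  apply/eqP/fK.
  rewrite (_ : _ - _ = {[x - s (p x), y]} + {[s (p x), y - s (p y)]}).
    by apply: memvD; [apply: mem_coml | apply: mem_comr].
  by rewrite brBl brBr addrA subrK.
have derD : derivation D.
  move=> a b; apply/eqP; rewrite -subr_eq0; apply/eqP/(ndQ _ (memvf _)) => w _.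
  rewrite -[a]sK -[b]sK -[w]sK; move: (s a) (s b) (s w) => x y t.
  rewrite killingBl killingDl [{[p x, D _]}]lie_bracketC -scaleN1r killingZl.
  rewrite !killing_bracket -!pbr !DE mulN1r br_jacobi linearD /=.
  by rewrite addrK subrr.
have [u Du] := derivation_inner ssQ derD.
have [W memW] : exists W : {vspace L}, forall v, v \in W <-> f v = killing u (p v).
  apply: (ex_vspace_pred (P := fun v => f v = killing u (p v))) => [|a x y fx fy].
    by rewrite !linear0.
  by rewrite lfun_linear !linearP fx fy.
(* On [[L, L]] the form [f] is [killing u] composed with [p], and [p z = 0]. *)
case/eqP: fz; suff /memW -> : z \in W.
  by have /eqP-> : p z == 0; rewrite ?ker_p // linear0.
apply: subvP zLL; apply/lie_mulP => x y _ _; apply/memW.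
by rewrite -DE Du killing_bracket pbr.
Qed.

End Radical.

(** * Coefficient extraction and a Cauchy product *)

(** Evaluating at [2 * t] and subtracting [2 ^+ n] times the value at [t] removes the top
    coefficient and multiplies [c k] by [2 ^+ k - 2 ^+ n], nonzero in characteristic 0. *)
Lemma vandermonde_mem (K : numFieldType) (V : vectType K) (W : {vspace V}) n
    (c : nat -> V) :
  (forall t : K, \sum_(k < n) t ^+ k *: c k \in W) ->
  forall k, (k < n)%N -> c k \in W.
Proof.
elim: n c => // n IHn c cW.
have lowW k : (k < n)%N -> c k \in W.
  move=> kn; have nz : (2 ^+ k - 2 ^+ n : K) != 0.
    by rewrite subr_eq0 -!natrX eqr_nat eqn_exp2l // ltn_eqF.
  rewrite -[c k](scalerK nz) memvZ //.
  apply: (IHn (fun k => (2 ^+ k - 2 ^+ n) *: c k)) => // t.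
  have := memvB (cW (2 * t)) (memvZ (2 ^+ n) (cW t)).
  rewrite !big_ord_recr /= scalerDr opprD addrACA scalerA -exprMn subrr addr0.
  rewrite scaler_sumr -sumrB; congr (_ \in W); apply: eq_bigr => i _.
  by rewrite !scalerA -scalerBl exprMn mulrBr mulrC [t ^+ i * 2 ^+ n]mulrC.
move=> k; rewrite ltnS leq_eqVlt => /predU1P[->|/lowW//].
have := cW 1; rewrite big_ord_recr /= expr1n scale1r addrC => h.
have sW : \sum_(i < n) 1 ^+ i *: c i \in W.
  by apply: memv_suml => i _; rewrite memvZ // lowW.
by rewrite -(addrK (\sum_(i < n) 1 ^+ i *: c i) (c n)) memvB.
Qed.

(** Summation along antidiagonals: those below [N + N] cover the square, and outside it the terms
    vanish. *)
Lemma sum_triangle (V : zmodType) (a : nat -> nat -> V) N :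
  (forall i j, (N <= i)%N || (N <= j)%N -> a i j = 0) ->
  \sum_(n < N + N) \sum_(i < n.+1) a i (n - i)%N = \sum_(i < N) \sum_(j < N) a i j.
Proof.
move=> a0; transitivity
  (\sum_(0 <= n < N + N) \sum_(0 <= i < N + N | (i <= n)%N) a i (n - i)%N).
  rewrite big_mkord; apply: eq_bigr => n _.
  rewrite -(big_mkord xpredT (fun i => a i (n - i)%N)).
  by rewrite (big_nat_widen _ _ (N + N)).
rewrite (exchange_big_dep_nat xpredT) //= big_mkord big_split_ord /=.
rewrite [X in _ + X]big1 ?addr0 => [|i _]; last first.
  by rewrite big1 // => n _; rewrite a0 // leq_addr.
apply: eq_bigr => i _; rewrite -(big_mkord xpredT (a i)).
have iN : (i <= N)%N by apply: ltnW.
have NNi : (N <= N + N - i)%N by rewrite -addnBA // leq_addr.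
rewrite (big_cat_nat (leq0n i)) /=; last by rewrite (leq_trans iN) ?leq_addr.
rewrite big_nat_cond big1 ?add0r => [|n /andP[/andP[_ ni]]]; last first.
  by rewrite leqNgt ni.
rewrite -{1}[i : nat]add0n big_addn (big_cat_nat (leq0n N)) //=.
rewrite [X in _ + X]big_nat_cond [X in _ + X]big1 ?addr0 => [|j /andP[/andP[Nj _] _]].
  apply: eq_big => j; first by rewrite leq_addl.
  by rewrite addnK.
by rewrite addnK a0 // Nj orbT.
Qed.

(** * Exponentials of nilpotent derivations *)

Section Exponential.
Variables (K : numFieldType) (L : lieAlgType K) (D : 'End(L)).
Hypothesis derD : forall x y, D {[x, y]} = {[D x, y]} + {[x, D y]}.
Implicit Types (u v : L).

(** Divided powers of [D], for which the Leibniz rule has no binomial coefficients. *)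
Definition lpow_fact k v : L := k`!%:R^-1 *: iter k D v.

Lemma lpow_fact_linear k : linear (lpow_fact k).
Proof.
move=> a u v; rewrite /lpow_fact iter_linear scalerDr !scalerA.
by rewrite mulrC.
Qed.

Lemma lpow_factS k v : D (lpow_fact k v) = k.+1%:R *: lpow_fact k.+1 v.
Proof.
rewrite /lpow_fact lfunZ scalerA factS natrM invfM mulrA divff ?mul1r //.
by rewrite pnatr_eq0.
Qed.

Lemma lpow_fact_leibniz n u v : lpow_fact n {[u, v]}
  = \sum_(i < n.+1) {[lpow_fact i u, lpow_fact (n - i) v]}.
Proof.
elim: n => [|n IHn].
  by rewrite big_ord1 /lpow_fact /= invr1 !scale1r.
have nz : n.+1%:R != 0 :> K by rewrite pnatr_eq0.
apply: (scalerI nz); rewrite -lpow_factS IHn linear_sum /=.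
under eq_bigr => i _ do rewrite derD !lpow_factS brZl brZr.
rewrite big_split /= scaler_sumr.
(* The two sums coming from [derD] carry the weights [i] and [n.+1 - i], which add up to [n.+1]. *)
transitivity (\sum_(i < n.+2) i%:R *: {[lpow_fact i u, lpow_fact (n.+1 - i) v]}
  + \sum_(i < n.+2) (n.+1 - i)%:R *: {[lpow_fact i u, lpow_fact (n.+1 - i) v]}).
  congr (_ + _); first by rewrite [RHS]big_ord_recl /= scale0r add0r.
  rewrite [RHS]big_ord_recr /= subnn scale0r addr0; apply: eq_bigr => i _.
  by rewrite subSn // -ltnS.
rewrite -big_split; apply: eq_bigr => i _ /=.
by rewrite -scalerDl -natrD subnKC // -ltnS.
Qed.

Variable N : nat.
Hypothesis nilD : forall v, iter N D v = 0.

(** The exponential of [D]: by [nilD] the truncation at [N] is the full series. *)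
Definition lexp v : L := \sum_(k < N) lpow_fact k v.

Lemma lexp_linear : linear lexp.
Proof.
move=> a u v; rewrite /lexp scaler_sumr -big_split; apply: eq_bigr => k _ /=.
exact: lpow_fact_linear.
Qed.

HB.instance Definition _ := GRing.isLinear.Build K L L *:%R lexp lexp_linear.

Lemma lexp_bracket u v : lexp {[u, v]} = {[lexp u, lexp v]}.
Proof.
have kill k w : (N <= k)%N -> lpow_fact k w = 0.
  by move=> Nk; rewrite /lpow_fact (iter_lfun_kill Nk) ?scaler0.
transitivity (\sum_(k < N + N) lpow_fact k {[u, v]}).
  rewrite big_split_ord /= [X in _ + X]big1 ?addr0 // => i _.
  by rewrite kill // leq_addr.
under eq_bigr do rewrite lpow_fact_leibniz.
rewrite (sum_triangle (a := fun i j => {[lpow_fact i u, lpow_fact j v]})).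
  rewrite /lexp lie_bracketC linear_sum -sumrN; apply: eq_bigr => i _ /=.
  by rewrite -lie_bracketC linear_sum.
by move=> i j /orP[/kill->|/kill->]; rewrite ?br0l ?br0r.
Qed.

(** Applying the last power of [D] that is nonzero on the line of [v] leaves only the leading term
    of the exponential. *)
Lemma lexp_eq0 v : lexp v = 0 -> v = 0.
Proof.
move=> ev; apply/eqP; apply: contraT => v0.
have [||m [w [/vlineP[a ->] wm killm]]] := @last_iter _ _ D <[v]>%VS v _ v0.
- exact: memv_line.
- by move=> w _; exists N.
have : iter m D (lexp (a *: v)) = iter m D (a *: v).
  have N0 : (0 < N)%N.
    by rewrite lt0n; apply: contra_neqN v0 => /eqP N0; rewrite -(nilD v) N0.
  rewrite /lexp; move: killm; case: N N0 => // N' _ killm; rewrite big_ord_recl.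
  rewrite iter_lfunD [X in _ + X](_ : _ = 0).
    by rewrite addr0 /lpow_fact invr1 scale1r.
  rewrite (big_morph _ (iter_lfunD D m) (iter_lfun0 D m)) big1 // => i _.
  rewrite /lpow_fact iter_lfunZ -iterD addnS -addSn addnC iterD.
  by rewrite killm ?iter_lfun0 ?scaler0 // memvZ ?memv_line.
by rewrite linearZ /= ev scaler0 iter_lfun0 => /esym/eqP; rewrite (negPf wm).
Qed.

Lemma lexp_frattini v :
  v \in frattini_ideal {:L}%VS -> lexp v \in frattini_ideal {:L}%VS.
Proof.
have ker0 : lker (linfun lexp) == 0%VS.
  rewrite -subv0; apply/subvP => w; rewrite memv_ker lfunE /= memv0.
  by move=> /eqP/lexp_eq0->.
rewrite -[lexp v](lfunE lexp).
apply: (@img_frattini K L L (linfun lexp) (linfun lexp)^-1%VF).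
  by move=> x y; rewrite !lfunE /= lexp_bracket.
exact: lker0_lfunVK.
Qed.

End Exponential.

(** * The Frattini and Jacobson ideals of a semisimple algebra *)

Section Frattini.
Variables (K : numClosedFieldType) (L : lieAlgType K).
Implicit Types (x y z u v w : L) (A B I J M N T U V W : {vspace L}).

(** [exp (t ad y) v] stays in the Frattini ideal for every scalar [t], and its coefficient at [t] is
    [[y, v]]. *)
Lemma ad_nilpotent_frattini y : geigen (ad y) 0 = fullv ->
  forall v, v \in frattini_ideal {:L}%VS -> {[y, v]} \in frattini_ideal {:L}%VS.
Proof.
move=> nily v vF.
have [|n killn] := @iter_lfun_uniform _ _ (ad y) fullv.
  move=> w; rewrite -nily => /geigenP[n wn]; exists n; rewrite -wn.
  by apply: eq_iter => u; rewrite eshiftE scale0r subr0.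
pose c k := lpow_fact (ad y) k v.
suff : c 1%N \in frattini_ideal {:L}%VS.
  by rewrite /c /lpow_fact invr1 scale1r /= adE.
(* Taking [n.+2] terms guarantees a coefficient of index 1 even for [n = 0]. *)
apply: (@vandermonde_mem _ _ _ n.+2) => // t.
have iter_t k w : iter k (ad (t *: y)) w = t ^+ k *: iter k (ad y) w.
  elim: k => [|k IHk]; first by rewrite scale1r.
  by rewrite !iterS IHk adE brZl brZr scalerA exprS -adE.
have killt w : iter n.+2 (ad (t *: y)) w = 0.
  by rewrite iter_t (iter_lfun_kill _ (killn w (memvf w))) ?scaler0 // ltnW.
have derad u w : ad (t *: y) {[u, w]} = {[ad (t *: y) u, w]} + {[u, ad (t *: y) w]}.
  by rewrite !adE br_jacobi.
have := lexp_frattini derad killt vF.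
rewrite /lexp (eq_bigr (fun k : 'I_n.+2 => t ^+ k *: c k)) // => k _.
by rewrite /c /lpow_fact iter_t !scalerA mulrC.
Qed.

(** [ad y] shifts eigenvalues of [ad x] by [a]. The values [b + k * a] are distinct in
    characteristic 0, so a chain that never vanished would exceed the spectrum. *)
Lemma geigen_ad_nilpotent x a y : a != 0 -> y \in geigen (ad x) a ->
  geigen (ad y) 0 = fullv.
Proof.
move=> a0 ya; apply: (@geigen_full _ _ (ad x)) => b; apply/subvP => v vb.
have [s [_ eigs _]] := ex_spectrum (ad x).
have iter_geigen k : iter k (ad y) v \in geigen (ad x) (b + k%:R * a).
  elim: k => [|k IHk]; first by rewrite mul0r addr0.
  by rewrite iterS adE -natr1 mulrDl mul1r addrA addrC br_geigen.
have [|/forallNP nz] := pselect (exists k, iter k (ad y) v = 0).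
  move=> [k vk]; apply/geigenP; exists k; rewrite -vk.
  by apply: eq_iter => u; rewrite eshiftE scale0r subr0.
pose t := [seq b + k%:R * a | k <- iota 0 (size s).+1].
have : (size t <= size s)%N.
  apply: uniq_leq_size.
    rewrite map_inj_uniq ?iota_uniq // => k l /addrI/(mulIf a0)/eqP.
    by rewrite eqr_nat => /eqP.
  move=> _ /mapP[k _ ->]; apply/eigs; apply: geigen_eigenvector (iter_geigen k) _.
  by apply/eqP; apply: nz.
by rewrite size_map size_iota ltnn.
Qed.

Hypothesis ssL : lie_semisimple L.

(* If X is the sum of the geigen (ad x) a with a != 0, then X + [X, X] is an
   ideal; it lies in any subalgebra containing X. *)
Lemma ideal_of_roots x W : lie_subalgebra fullv W ->
    (forall a, a != 0 -> (geigen (ad x) a <= W)%VS) ->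
  exists T, [/\ lie_ideal fullv T, (T <= W)%VS &
                forall a, a != 0 -> (geigen (ad x) a <= T)%VS].
Proof.
move=> /andP[_ WW] rootW.
(* The sum over infinitely many [a] is encoded as the least subspace containing all these
   eigenspaces. *)
pose X := vspace_bigcap fullv (fun U => forall a, a != 0 -> (geigen (ad x) a <= U)%VS).
have rootX a : a != 0 -> (geigen (ad x) a <= X)%VS.
  move=> a0; apply/subvP => v va; apply/vspace_bigcapP; split=> [|U hU].
    exact: memvf.
  exact: subvP (hU a a0) v va.
have minX U : (forall a, a != 0 -> (geigen (ad x) a <= U)%VS) -> (X <= U)%VS.
  by move=> hU; apply/subvP => v /vspace_bigcapP[_]; apply.
pose G0 := geigen (ad x) 0.
have full : (X + G0)%VS = fullv.
  apply: (@geigen_full _ _ (ad x)) => a; have [->|a0] := eqVneq a 0.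
    exact: addvSr.
  exact: subv_trans (rootX a a0) (addvSl _ _).
have G0X : (lie_mul G0 X <= X)%VS.
  apply/lie_mulP => q v q0; suff sub : (X <= ad q @^-1: X)%VS.
    by move=> /(subvP sub); rewrite -memv_preim adE.
  apply: minX => a a0; apply/subvP => u ua; rewrite -memv_preim adE.
  by apply: (subvP (rootX a a0)); rewrite -[a]add0r br_geigen.
pose T := (X + lie_mul X X)%VS.
have XT : (X <= T)%VS by apply: addvSl.
have XXT : (lie_mul X X <= T)%VS by apply: addvSr.
have XfT : (lie_mul X fullv <= T)%VS.
  by rewrite -full lie_mulDr subv_add XXT lie_mulC (subv_trans G0X).
have G0XX : (lie_mul G0 (lie_mul X X) <= lie_mul X X)%VS.
  apply/lie_mulP => q v q0.
  suff sub : (lie_mul X X <= ad q @^-1: lie_mul X X)%VS.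
    by move=> /(subvP sub); rewrite -memv_preim adE.
  have qX u : u \in X -> {[q, u]} \in X.
    by move=> uX; apply: (subvP G0X); apply: mem_lie_mul.
  apply/lie_mulP => u w uX wX; rewrite -memv_preim adE br_jacobi.
  by rewrite memvD // mem_lie_mul // qX.
exists T; split=> [||a a0].
- rewrite lie_ideal_fullP -[X in lie_mul X _]full lie_mulDl subv_add.
  rewrite (subv_trans _ XfT) ?lie_mulS ?subvf //= lie_mulDr subv_add.
  by rewrite (subv_trans G0X) ?(subv_trans G0XX).
- have XW : (X <= W)%VS by apply: minX.
  by rewrite subv_add XW (subv_trans _ WW) // lie_mulS.
- exact: subv_trans (rootX a a0) XT.
Qed.

(** The stabilizer [N] of [F] contains the generalized eigenvectors for nonzero eigenvalues, and so
    does the largest ideal [E] in [N], by [ideal_of_roots]. For [c] in [killing_perp E] and such an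
    eigenvector [v] of [ad c], [[c, v]] lies in both ideals and is 0. So [ad c] is nilpotent, the
    nil ideal [killing_perp E] is 0, and [E] is everything. *)
Lemma semisimple_frattini_ideal : lie_ideal fullv (frattini_ideal {:L}%VS).
Proof.
set F := frattini_ideal _.
have [N memN] : exists N, forall z, z \in N <-> forall v, v \in F -> {[z, v]} \in F.
  apply: (ex_vspace_pred (P := fun z => forall v, v \in F -> {[z, v]} \in F)).
    by move=> v _; rewrite br0l mem0v.
  by move=> a y z hy hz v vF; rewrite brDl brZl memvD ?memvZ ?hy ?hz.
have subN : lie_subalgebra fullv N.
  apply/lie_subalgebraP; split=> [|y z /memN hy /memN hz]; first exact: subvf.
  apply/memN => v vF; rewrite -[{[_, v]}](addrK {[z, {[y, v]}]}) -br_jacobi.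
  by apply: memvB; [apply/hy/hz | apply/hz/hy].
have rootN x a : a != 0 -> (geigen (ad x) a <= N)%VS.
  move=> a0; apply/subvP => y ya; apply/memN.
  exact: ad_nilpotent_frattini (geigen_ad_nilpotent a0 ya).
have [||E [[idE EN] maxE]] := @ex_largest_vspace _ L
  (fun I => lie_ideal fullv I /\ (I <= N)%VS).
- by split; [apply: lie_ideal0 | apply: sub0v].
- by move=> A B [iA sA] [iB sB]; rewrite subv_add sA sB; split=> //; apply: lie_idealD.
have rootE x a : a != 0 -> (geigen (ad x) a <= E)%VS.
  have [T [idT TN rootT]] := ideal_of_roots subN (rootN x).
  by move=> a0; apply: subv_trans (rootT a a0) _; apply: maxE.
have idC := killing_perp_ideal idE.
suff C0 : killing_perp E = 0%VS.
  have fE : E = fullv by rewrite -(killing_perp_compl ssL idE) C0 addv0.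
  apply/lie_idealP; split=> [|y v _ vF]; first exact: subvf.
  have /memN : y \in N by apply: (subvP EN); rewrite fE memvf.
  exact.
apply: (semisimple_nil_ideal ssL) => // c cC.
apply: (@geigen_full _ _ (ad c)) => a.
have [->|a0] := eqVneq a 0; first exact: subvv.
apply/subvP => v va; suff : {[c, v]} = 0.
  by move=> cv; apply/geigenP; exists 1%N; rewrite /= eshiftE adE cv scale0r subr0.
apply/eqP; rewrite -memv0 -(killing_perp_cap ssL idE) memv_cap.
by rewrite ideal_brr ?(ideal_brl _ idC) // (subvP (rootE c a a0)).
Qed.

(** If the complement of [T] were proper, a maximal member above it would also contain [T], hence
    everything. *)
Lemma semisimple_max_sub (P : pred {vspace L}) T :
    (forall I, lie_ideal fullv I -> P I) -> lie_ideal fullv T ->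
  (forall M, maximal_proper P fullv M -> (T <= M)%VS) -> T = 0%VS.
Proof.
move=> idP idT subM; have idC := killing_perp_ideal idT.
have [Cf|Cf] := eqVneq (killing_perp T) fullv.
  by rewrite -(killing_perp_cap ssL idT) Cf capvf.
have [||M [maxM CM]] := @ex_maximal_proper _ _ P fullv _ _ _ Cf.
- by move=> N _; apply: subvf.
- exact: idP.
case: (maxM) => _ /eqP Mf _; case: Mf; apply/eqP.
by rewrite eqEsubv subvf -(killing_perp_compl ssL idT) subv_add subM.
Qed.

Lemma semisimple_frattini0 : frattini_ideal {:L}%VS = 0%VS.
Proof.
apply: semisimple_max_sub semisimple_frattini_ideal _ => [I|M].
  exact: ideal_subalgebra.
exact: frattini_max.
Qed.

Lemma jacobson_is_ideal : lie_ideal fullv (jacobson_ideal {:L}%VS).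
Proof.
apply/lie_idealP; split=> [|x v _ /vspace_bigcapP[_ vM]]; first exact: subvf.
apply/vspace_bigcapP; split=> [|M maxM]; first exact: memvf.
by have [idM _ _] := maxM; apply: ideal_brr => //; apply: vM.
Qed.

Lemma semisimple_jacobson0 : jacobson_ideal {:L}%VS = 0%VS.
Proof.
apply: (semisimple_max_sub (P := lie_ideal fullv)) jacobson_is_ideal _ => // M.
exact: jacobson_max.
Qed.

End Frattini.

(** * Comparison of the indices *)

Section FrattiniJacobson.
Variables (K : numClosedFieldType) (L : lieAlgType K).
Implicit Types (M N : {vspace L}).

Let C := commutator_radical L.

Lemma frattini_jacobson_sub_commutator :
  (frattini_ideal {:L}%VS <= C)%VS /\ (jacobson_ideal {:L}%VS <= C)%VS.
Proof.
have [[idR _] _] := lie_radicalP L.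
have [Q [p [s [pbr sK ker_p]]]] := ex_lie_quotient idR.
have ssQ := radical_quotient_semisimple pbr sK ker_p.
have LL : (lie_mul {:L} {:L} <= {:L})%VS by apply: subvf.
have cap := derived_cap_radical pbr sK ker_p.
split; apply: subv_trans cap; rewrite subv_cap.
  rewrite frattini_sub_derived //; apply/subvP => v /(img_frattini pbr sK).
  by rewrite (semisimple_frattini0 ssQ) memv0 ker_p.
rewrite jacobson_sub_derived //; apply/subvP => v /(img_jacobson pbr sK).
by rewrite (semisimple_jacobson0 ssQ) memv0 ker_p.
Qed.

(** [C] lies both in the radical and in [[L, L]]. A maximal ideal [M] containing neither would give
    a nonzero quotient [L/M] that is solvable, as an image of the radical, and perfect. *)
Lemma commutator_sub_jacobson : (C <= jacobson_ideal {:L}%VS)%VS.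
Proof.
have [[idR [n /eqP Rn0]] _] := lie_radicalP L.
apply/subvP => v vC; apply/vspace_bigcapP; split=> [|M [idM Mf maxM]].
  exact: memvf.
set R := lie_radical L in idR Rn0.
have idMR := lie_idealD idM idR.
have [MRf|MRf] := eqVneq (M + R)%VS fullv; last first.
  have RM : (R <= M)%VS by rewrite -(maxM _ idMR MRf (addvSl _ _)) addvSr.
  apply: (subvP RM); apply: subvP vC; rewrite -lie_ideal_fullP; exact: idR.
have mulM U : (lie_mul M U <= M)%VS.
  by apply/lie_mulP => x y xM _; apply: ideal_brl.
have idML : lie_ideal fullv (M + lie_mul fullv fullv)%VS.
  by apply: lie_idealD => //; apply: lie_ideal_mul; apply: lie_idealf.
have [MLf|MLf] := eqVneq (M + lie_mul {:L} {:L})%VS fullv; last first.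
  have LM : (lie_mul {:L} {:L} <= M)%VS.
    by rewrite -(maxM _ idML MLf (addvSl _ _)) addvSr.
  by apply: (subvP LM); apply: subvP vC; apply: lie_mulS; rewrite subvf.
have step (A B : {vspace L}) : (M + A)%VS = fullv -> (M + B)%VS = fullv ->
    (lie_mul fullv fullv <= M + lie_mul A B)%VS.
  move=> fA fB; rewrite -{1}fA -fB lie_mulDl subv_add (subv_trans (mulM _)) ?addvSl //=.
  rewrite lie_mulDr addvS // lie_mulC; exact: mulM.
have all k : (M + lie_derived R k)%VS = fullv.
  elim: k => [|k IHk] //=; apply/eqP; rewrite eqEsubv subvf -MLf subv_add addvSl.
  exact: step.
by have := all n; rewrite Rn0 addv0 => Mfull; rewrite Mfull eqxx in Mf.
Qed.

Lemma jacobson_commutator_radical : jacobson_ideal {:L}%VS = C.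
Proof.
apply/eqP; rewrite eqEsubv commutator_sub_jacobson andbT.
by case: frattini_jacobson_sub_commutator.
Qed.

(** If [M + [N, N]] is everything, the modular law gives [N = (M :&: N) + [N, N]], so [M] contains
    [N] by [nilpotent_generate]; otherwise maximality puts [[N, N]] in [M]. *)
Lemma derived_nilradical_sub_frattini :
  (lie_mul (lie_nilradical L) (lie_nilradical L) <= frattini_ideal {:L}%VS)%VS.
Proof.
have [[idN nilN] _] := lie_nilradicalP L; set N := lie_nilradical L in idN nilN *.
have idNN := lie_ideal_mul idN idN.
have NN : (lie_mul N N <= N)%VS by apply/lie_mulP => x y _; apply: ideal_brr.
apply/subvP => v vNN; apply/vspace_bigcapP; split=> [|M [/andP[_ MM] Mf maxM]].
  exact: memvf.
have subM : lie_subalgebra fullv (M + lie_mul N N)%VS.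
  rewrite /lie_subalgebra subvf /= lie_mulDr subv_add; apply/andP; split.
    rewrite lie_mulDl addvS //; apply/lie_mulP => x y xN _; exact: ideal_brl.
  apply: subv_trans (addvSr _ _); apply/lie_mulP => x y _; exact: ideal_brr.
have [MNf|MNf] := eqVneq (M + lie_mul N N)%VS fullv; last first.
  by apply: subvP vNN; rewrite -(maxM _ subM MNf (addvSl _ _)) addvSr.
have vN := subvP NN v vNN; apply: subvP vN.
have NM : (N <= (M :&: N))%VS.
  apply: nilpotent_generate => //; first exact: capvSr.
    apply/lie_mulP => x y; rewrite !memv_cap => /andP[xM xN] /andP[yM yN].
    by rewrite (subvP MM) ?mem_lie_mul //= (subvP NN) ?mem_lie_mul.
  apply/subvP => x xN; have : x \in (M + lie_mul N N)%VS by rewrite MNf memvf.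
  case/memv_addP=> m mM [k kNN def_x]; apply/memv_addP; exists m; last by exists k.
  rewrite memv_cap mM; have -> : m = x - k by rewrite def_x addrK.
  by rewrite memvB // (subvP NN).
exact: subv_trans NM (capvSl _ _).
Qed.

Lemma commutator_nilpotent : lie_nilpotent C.
Proof.
have [[idR solR] _] := lie_radicalP L.
exact: commutator_solvable_nilpotent.
Qed.

Lemma commutator_ideal : lie_ideal fullv C.
Proof.
have [[idR _] _] := lie_radicalP L.
by apply: lie_ideal_mul => //; apply: lie_idealf.
Qed.

Lemma commutator_sub_nilradical : (C <= lie_nilradical L)%VS.
Proof.
have [_ maxN] := lie_nilradicalP L; apply: maxN.
by split; [apply: commutator_ideal | apply: commutator_nilpotent].
Qed.

(** [C = L] would give [[C, L] = L], against [commutator_solvable_shrinks] for the nonzero ideal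
    [L]. *)
Lemma commutator_proper : {:L}%VS <> 0%VS -> C != fullv.
Proof.
move=> L0; have [[idR solR] _] := lie_radicalP L.
apply/negP => /eqP Cf; have := commutator_solvable_shrinks idR solR (lie_idealf L).
have L0' : {:L}%VS != 0%VS by apply/eqP.
move=> /(_ L0'); rewrite -/(commutator_radical L) -/C Cf => /negP[].
by rewrite eqEsubv subvf -{1}Cf lie_mulS // subvf.
Qed.

Lemma frattini_subalgebra :
  (lie_mul (frattini_ideal fullv) (frattini_ideal fullv) <= frattini_ideal {:L}%VS)%VS.
Proof.
apply/lie_mulP => x y /vspace_bigcapP[_ xM] /vspace_bigcapP[_ yM].
apply/vspace_bigcapP; split=> [|M maxM]; first exact: memvf.
have [/lie_subalgebraP[_ MM] _ _] := maxM.
by apply: MM; [apply: xM | apply: yM].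
Qed.

End FrattiniJacobson.

Section Indexes.
Variables (K : numClosedFieldType) (L : lieAlgType K).

(** The zero algebra is excluded: its index is 0, while the right-hand side would be 1. *)
Lemma jacobson_indexE : {:L}%VS <> 0%VS ->
  jacobson_index {:L}%VS = (solvability_index (commutator_radical L) + 1)%N.
Proof.
move=> L0; rewrite /jacobson_index -(jacobson_commutator_radical L).
have CC := ideal_subalgebra (commutator_ideal L).
apply: stationary_index; rewrite jacobson_commutator_radical.
- exact: commutator_proper.
- exact: commutator_radical_solvable.
- move=> k; apply: iter_jacobson_nilpotent; first exact: subalgebra_mul.
  exact: commutator_nilpotent.
Qed.

Lemma frattini_indexE : {:L}%VS <> 0%VS ->
  frattini_index {:L}%VS = (solvability_index (frattini_ideal {:L}%VS) + 1)%N.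
Proof.
move=> L0; have [FC _] := frattini_jacobson_sub_commutator L.
apply: stationary_index.
- apply: contraNneq (commutator_proper L0) => Ff.
  by rewrite eqEsubv subvf -[X in (X <= _)%VS]Ff.
- exact: lie_solvableS FC (commutator_radical_solvable L).
- move=> k; apply: iter_frattini_nilpotent; first exact: frattini_subalgebra.
  exact: lie_nilpotentS FC (commutator_nilpotent L).
Qed.

Lemma frattini_jacobson_indexes : {:L}%VS <> 0%VS ->
  [/\ solvability_index (lie_nilradical L) <= frattini_index {:L}%VS,
      frattini_index {:L}%VS <= jacobson_index {:L}%VS &
      solvability_index (commutator_radical L)
        <= solvability_index (lie_nilradical L)]%N.
Proof.
move=> L0; have [FC _] := frattini_jacobson_sub_commutator L.
have solC := commutator_radical_solvable L.
rewrite jacobson_indexE // frattini_indexE // leq_add2r; split.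
(* From [[N, N] <= F(L)]: [i_s(N) <= i_s([N, N]) + 1 <= i_s(F(L)) + 1]. *)
- apply: leq_trans (solvability_index_mul (nilradical_solvable L)) _.
  rewrite leq_add2r; apply: solvability_indexS (lie_solvableS FC solC) _.
  exact: derived_nilradical_sub_frattini.
- exact: solvability_indexS.
- exact: solvability_indexS (nilradical_solvable L) (commutator_sub_nilradical L).
Qed.

End Indexes.

Theorem proposition9p17 (R : realType) :
  (forall L : lieAlgType R[i], lie_nilpotent {:L}%VS ->
     frattini_index {:L}%VS = jacobson_index {:L}%VS /\
     jacobson_index {:L}%VS = solvability_index {:L}%VS) /\
  (forall L : lieAlgType R[i], {:L}%VS <> 0%VS ->
     [/\ solvability_index (lie_nilradical L) <= frattini_index {:L}%VS,
         frattini_index {:L}%VS <= jacobson_index {:L}%VS,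
         jacobson_index {:L}%VS
           = solvability_index (commutator_radical L) + 1 &
         solvability_index (commutator_radical L) + 1
           <= solvability_index (lie_nilradical L) + 1] /\
     [/\ 1 <= frattini_index {:L}%VS,
         frattini_index {:L}%VS <= jacobson_index {:L}%VS &
         jacobson_index {:L}%VS <= frattini_index {:L}%VS + 1])%N.
Proof.
split=> [L nilL|L L0].
  by have [-> ->] := nilpotent_indexes nilL.
have jE := @jacobson_indexE R[i] L L0.
have fE := @frattini_indexE R[i] L L0.
have [NF FJ CN] := @frattini_jacobson_indexes R[i] L L0.
split; split=> //.
- by rewrite leq_add2r.
- by rewrite fE addn1.
- by rewrite jE leq_add2r (leq_trans CN).
Qed.
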